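(* Let $G_m$ be a bounded Vilenkin group, $1\le p<\infty$ and $f\in L_p(G_m)$. Then $$\|R_nf-f\|_p\to0\quad\text{as }n\to\infty .$$ Moreover, $$\lim_{n\to\infty}R_nf(x)=f(x)$$ for all Vilenkin–Lebesgue points $x$ of $f$.
   Context: Let $m=(m_0,m_1,\ldots)$ be a fixed sequence of integers $m_k\ge 2$ with $\sup_k m_k<\infty$. $G_m=\prod_{k\ge0}Z_{m_k}$, $Z_{m_k}=\{0,\ldots,m_k-1\}$ the integers mod $m_k$, is the bounded Vilenkin group with product (of discrete) topology and normalized Haar measure $\mu$. $I_0(x)=G_m$, $I_n(x)=\{y\in G_m: y_0=x_0,\ldots,y_{n-1}=x_{n-1}\}$; $e_s\in G_m$ has $s$-th coordinate $1$ and all others $0$. $M_0=1$, $M_{k+1}=m_kM_k$; every $n\in\mathbb{N}=\{0,1,\ldots\}$ is uniquely $n=\sum_j n_jM_j$ with $n_j\in Z_{m_j}$. $r_k(x)=\exp(2\pi i x_k/m_k)$ and $\psi_n=\prod_k r_k^{n_k}$ (Vilenkin system). For $f\in L_1(G_m)$: $\widehat f(n)=\int_{G_m} f\overline{\psi_n}\,d\mu$, $S_nf=\sum_{k=0}^{n-1}\widehat f(k)\psi_k$. $\|g\|_p=(\int_{G_m}|g|^pd\mu)^{1/p}$. Riesz logarithmic means: for $n\ge2$, $R_nf=\frac1{l_n}\sum_{k=1}^{n-1}\frac{S_kf}{k}$ with $l_n=\sum_{k=1}^{n-1}\frac1k$. For $f\in L_1(G_m)$ and $A\in\mathbb{N}$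 put $$W_Af(x)=\sum_{s=0}^{A-1}M_s\sum_{r_s=1}^{m_s-1}\int_{I_A(x-r_se_s)}|f(t)-f(x)|\,d\mu(t)$$ (here $r_s$ is a summation index). A point $x\in G_m$ is a Vilenkin–Lebesgue point of $f$ if $\lim_{A\to\infty}W_Af(x)=0$. *)

(* Defs.v *)
From HB Require Import structures.
From mathcomp Require Import all_boot all_order all_algebra.
From mathcomp Require Import all_classical all_reals all_analysis.
From mathcomp Require Import complex.

Set Implicit Arguments.
Unset Strict Implicit.
Unset Printing Implicit Defensive.
Import Order.TTheory GRing.Theory Num.Theory.
Import numFieldNormedType.Exports.
Local Open Scope classical_set_scope.
Local Open Scope ring_scope.
Local Open Scope complex_scope.

(* [vilenkin m] is the group G_m = \prod_k Z_(m_k).  Since 'Z_n is the ring of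
   integers mod n only for 1 < n, it is meant for sequences with 2 <= m k.    *)
Definition vilenkin (m : nat -> nat) := forall k : nat, 'Z_(m k).

Section VilenkinGroup.
Variable m : nat -> nat.
Local Notation G := (vilenkin m).

HB.instance Definition _ :=
  Topological.copy G (prod_topology (fun k => discrete_topology 'Z_(m k))).

HB.instance Definition _ := isPointed.Build G (fun k => 0).

Let addv (x y : G) : G := fun k => x k + y k.
Let oppv (x : G) : G := fun k => - x k.
Let zerov : G := fun k => 0.

Let addvA : associative addv.
Proof. by move=> x y z; apply: functional_extensionality_dep => k; exact: addrA. Qed.

Let addvC : commutative addv.
Proof. by move=> x y; apply: functional_extensionality_dep => k; exact: addrC. Qed.

Let add0v : left_id zerov addv.
Proof. by move=> x; apply: functional_extensionality_dep => k; exact: add0r. Qed.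

Let addNv : left_inverse zerov oppv addv.
Proof. by move=> x; apply: functional_extensionality_dep => k; exact: addNr. Qed.

HB.instance Definition _ := GRing.isZmodule.Build G addvA addvC add0v addNv.

(* The Borel sigma-algebra. *)
HB.instance Definition _ :=
  Measurable.copy G (g_sigma_algebraType (@open G)).

End VilenkinGroup.

Section VilenkinSystem.
Variables (R : realType) (m : nat -> nat).
Local Notation G := (vilenkin m).
Implicit Types (x : G) (n k s A : nat).

Definition vcylinder n x : set G := [set y | forall k, (k < n)%N -> y k = x k].

Definition vunit s : G := fun k => if k == s then 1 else 0.

Definition vM n : nat := \prod_(k < n) m k.

Definition vdigit n k : nat := (n %/ vM k) %% m k.

Definition rademacher k x : R[i] :=
  let theta : R := 2 * pi * (x k : nat)%:R / (m k)%:R in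
  cos theta +i* sin theta.

(* The product may be cut at k < n, see [vdigit_eq0]. *)
Definition vilenkin_fun n x : R[i] :=
  \prod_(k < n) rademacher k x ^+ vdigit n k.

End VilenkinSystem.

Section Digits.
Variable m : nat -> nat.
Hypothesis m2 : forall k, (2 <= m k)%N.
Local Open Scope nat_scope.

Lemma ltn_vM n : n < vM m n.
Proof.
elim: n => [|n IH]; first by rewrite /vM big_ord0.
rewrite /vM big_ord_recr /= -/(vM m n).
apply: (@leq_trans (vM m n * 2)); last by rewrite leq_mul2l m2 orbT.
by rewrite muln2 -addnn -(addn1 n.+1) leq_add// (leq_ltn_trans _ IH).
Qed.

Lemma leq_vM k n : k <= n -> vM m k <= vM m n.
Proof.
move=> /subnK <-; elim: (n - k) => // j IH; rewrite addSn.
apply: (leq_trans IH); rewrite {2}/vM big_ord_recr /= -/(vM m (j + k)).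
by rewrite leq_pmulr// (leq_trans _ (m2 _)).
Qed.

Lemma vdigit_eq0 n k : n <= k -> vdigit m n k = 0.
Proof.
move=> nk; rewrite /vdigit divn_small ?mod0n//.
exact: leq_ltn_trans nk (ltn_vM k).
Qed.

Lemma vdigit_lt n k : vdigit m n k < m k.
Proof. by rewrite ltn_mod (leq_trans _ (m2 k)). Qed.

Lemma vdigitE n : n = \sum_(k < n) vdigit m n k * vM m k.
Proof.
have E K : n = \sum_(k < K) vdigit m n k * vM m k + (n %/ vM m K) * vM m K.
  elim: K => [|K IH]; first by rewrite big_ord0 /vM big_ord0 divn1 muln1.
  rewrite big_ord_recr /= {1}IH -addnA; congr (_ + _).
  rewrite [vM m K.+1]/vM big_ord_recr /= -/(vM m K) divnMA.
  rewrite (mulnC (vM m K)) mulnA -mulnDl addnC /vdigit.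
  by rewrite -divn_eq.
by rewrite {1}(E n) divn_small ?ltn_vM// mul0n addn0.
Qed.

End Digits.

Section ComplexIntegration.
Context d (T : measurableType d) (R : realType).
Variable mu : {measure set T -> \bar R}.

Definition complex_integral (f : T -> R[i]) : R[i] :=
  (\int[mu]_t complex.Re (f t)) +i* (\int[mu]_t complex.Im (f t)).

Definition complex_Lnorm (p : R) (f : T -> R[i]) : \bar R :=
  Lnorm mu p%:E (fun t => (ComplexField.Normc.normc (f t))%:E).

Definition complex_Lp (p : R) (f : T -> R[i]) : Prop :=
  [/\ measurable_fun setT (fun t => complex.Re (f t)),
      measurable_fun setT (fun t => complex.Im (f t)) &
      (complex_Lnorm p f < +oo)%E].

End ComplexIntegration.

Section RieszMeans.
Variables (R : realType) (m : nat -> nat).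
Local Notation G := (vilenkin m).
Variable mu : probability G R.
Implicit Types (f : G -> R[i]) (x : G) (n A : nat).

(* [mu] is the normalized Haar measure.  Inner and outer regularity are
   automatic on a compact metrizable group. *)
Definition haar : Prop :=
  forall (x : G) (B : set G), measurable B -> mu [set x + y | y in B] = mu B.

Definition fourier_coef f n : R[i] :=
  complex_integral mu (fun t => f t * (vilenkin_fun R n t)^*).

Definition fourier_sum n f x : R[i] :=
  \sum_(k < n) fourier_coef f k * vilenkin_fun R k x.

Definition harmonic_sum n : R := \sum_(1 <= k < n) k%:R^-1.

Definition riesz_mean n f x : R[i] :=
  ((harmonic_sum n)^-1)%:C * \sum_(1 <= k < n) fourier_sum k f x / k%:R.

Definition vilenkin_W A f x : \bar R :=
  (\sum_(s < A) (vM m s)%:R%:E *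
     \sum_(1 <= r < m s)
       \int[mu]_(t in vcylinder A (x - vunit m s *+ r)%R)
         (ComplexField.Normc.normc (f t - f x)%R)%:E)%E.

Definition vilenkin_lebesgue_point f x : Prop :=
  vilenkin_W A f x @[A --> \oo] --> 0%E.

End RieszMeans.

(* Main.v *)
Require Import Defs.
From HB Require Import structures.
From mathcomp Require Import all_boot all_order all_algebra.
From mathcomp Require Import all_classical all_reals all_analysis.
From mathcomp Require Import complex measurable_realfun.
From mathcomp Require Import ring lra zify.

Set Implicit Arguments.
Unset Strict Implicit.
Unset Printing Implicit Defensive.
Import Order.TTheory GRing.Theory Num.Theory.
Import numFieldNormedType.Exports.
Local Open Scope classical_set_scope.
Local Open Scope ring_scope.

(* The digit recursions of the Dirichlet kernels D_n give recursions for the sums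
   F_n = D_0 + ... + D_(n-1).  Unrolling the one for F_(M_l) bounds |F_(M_l)| / M_l,
   up to a constant depending on sup m only, by the nonnegative kernel
     Psi_l(x, t) = sum_(s < l) M_s sum_(r < m_s) 1[t in I_l(x - r e_s)] + M_l 1[t in I_l(x)],
   and hence |F_n| by the sum of M_l Psi_l over the l with M_l <= n.  After Abel
   summation, |sum_(1 <= k < n) D_k / k| is at most a constant times the sum of
   Psi_l over l <= A, where M_A <= n < M_(A+1); since l_n is at least a constant
   times A + 1, |R_n f(x) - f(x)| is at most a constant times the Cesaro mean over
   l <= A of the integrals w_l(x) of Psi_l(x, t) |f(t) - f(x)| with respect to t.

   Pointwise: w_l(x) is W_l f(x) plus at most 2 M_l times the integral of
   |f - f(x)| over I_l(x).  The term s = l of W_(l+1) f(x) controls the integral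
   over I_l(x) \ I_(l+1)(x), so at a Vilenkin-Lebesgue point telescoping gives
   w_l(x) -> 0, and the Cesaro means follow.

   In norm: both marginals of Psi_l have mass at most 3, so it is enough that the
   double integral of Psi_l(x, t) |f(t) - f(x)|^p tends to 0.  This holds for the
   indicators of unions of cylinders of a fixed level, is stable under dominated
   pointwise limits, and the sets whose indicator satisfies it form a
   sigma-algebra; simple functions and monotone approximation give all of L_p. *)

(** * Rademacher functions as characters *)

Section Rademacher.
Variables (R : realType) (m : nat -> nat).
Hypothesis m2 : forall k, (2 <= m k)%N.
Local Notation G := (vilenkin m).
Implicit Types (x y : G) (k : nat).

Definition cis (t : R) : R[i] := Complex (cos t) (sin t).

Lemma cisD s t : cis (s + t) = cis s * cis t.
Proof. by apply/eqP; rewrite eq_complex /= cosD sinD eqxx addrC eqxx. Qed.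

Lemma cis0 : cis 0 = 1.
Proof. by rewrite /cis cos0 sin0. Qed.

Lemma cisMn t n : cis (t *+ n) = cis t ^+ n.
Proof. by elim: n => [|n IH]; rewrite ?cis0// mulrS cisD IH exprS. Qed.

Lemma norm_cis t : `|cis t| = 1.
Proof. by rewrite normc_def /= cos2Dsin2 sqrtr1. Qed.

Lemma rademacherE k x :
  rademacher R k x = cis (2 * pi / (m k)%:R) ^+ (x k : nat).
Proof.
rewrite -cisMn /rademacher -/(cis _); congr cis.
by rewrite -mulr_natr; ring.
Qed.

(** Addition in ['Z_(m k)] reduces exponents modulo [m k], and a root of unity of order dividing
    [m k] does not see the reduction. The bound [m2] makes the modulus of ['Z_(m k)] really
    [m k]. *)
Lemma rademacherD k x y :
  rademacher R k (x + y) = rademacher R k x * rademacher R k y.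
Proof.
rewrite !rademacherE -exprD.
have mk0 : (m k)%:R != 0 :> R by rewrite pnatr_eq0 -lt0n (leq_trans _ (m2 k)).
have wm : cis (2 * pi / (m k)%:R) ^+ m k = 1.
  rewrite -cisMn -[_ *+ m k]mulr_natr divfK// mulr_natl.
  by rewrite /cis -[pi *+ 2]add0r cosD2pi sinD2pi cos0 sin0.
have -> : ((x + y)%R k : nat) = ((x k + y k) %% m k)%N.
  by rewrite -[X in (_ %% X)%N](Zp_cast (m2 k)).
by rewrite (expr_mod _ wm).
Qed.

Lemma rademacher0 k : rademacher R k (0 : G) = 1.
Proof. by rewrite rademacherE expr0. Qed.

Lemma norm_rademacher k x : `|rademacher R k x| = 1.
Proof. by rewrite rademacherE normrX norm_cis expr1n. Qed.

Lemma rademacherN k x : rademacher R k (- x) = conjc (rademacher R k x).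
Proof.
have e : rademacher R k x * rademacher R k (- x) = 1.
  by rewrite -rademacherD subrr rademacher0.
have e' : rademacher R k x * conjc (rademacher R k x) = 1.
  by have := normCK (rademacher R k x); rewrite norm_rademacher expr1n => <-.
have r0 : rademacher R k x != 0 by rewrite -normr_eq0 norm_rademacher oner_eq0.
by apply: (mulfI r0); rewrite e e'.
Qed.

(** The angle t satisfies 0 < t / 2 < pi, so sin (t / 2) > 0, while cos t = cos^2 (t / 2) - sin^2 (t
    / 2) is then less than 1. *)
Lemma rademacher_neq1 k x : x k != 0 -> rademacher R k x != 1.
Proof.
move=> xk0; apply/eqP => /eqP; rewrite eq_complex => /andP[+ _].
pose t : R := 2 * pi * (x k : nat)%:R / (m k)%:R.
move=> /eqP; rewrite /= -/t.
have mk0 : 0 < (m k)%:R :> R by rewrite ltr0n (leq_trans _ (m2 k)).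
have h0 : 0 < sin (t / 2).
  have -> : t / 2 = pi * (x k : nat)%:R / (m k)%:R by rewrite /t; field; rewrite gt_eqF.
  have xk_gt0 : (0 < x k)%N by rewrite lt0n.
  apply: sin_gt0_pi; apply/andP; split.
    by rewrite divr_gt0// mulr_gt0 ?pi_gt0// ltr0n.
  rewrite ltr_pdivrMr// ltr_pM2l ?pi_gt0// ltr_nat.
  by have := ltn_ord (x k); rewrite [X in (_ < X)%N]Zp_cast.
have {1}-> : t = t / 2 + t / 2 by field.
rewrite cosD -!expr2.
have := cos2Dsin2 (t / 2); nra.
Qed.

Lemma rademacher_expm k x : rademacher R k x ^+ m k = 1.
Proof.
rewrite rademacherE exprAC -cisMn -[_ *+ m k]mulr_natr divfK; last first.
  by rewrite pnatr_eq0 -lt0n (leq_trans _ (m2 k)).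
by rewrite mulr_natl /cis -[pi *+ 2]add0r cosD2pi sinD2pi cos0 sin0 expr1n.
Qed.

(** Geometric sum of an [m k]-th root of unity. It supplies the factor 1[x_k = 0] in the recursions
    on the leading digit. *)
Lemma sum_rademacher k x :
  \sum_(j < m k) rademacher R k x ^+ j = (m k * (x k == 0))%:R.
Proof.
case: eqP => [xk0|/eqP xk0].
  rewrite muln1 (eq_bigr (fun=> 1)) ?sumr_const ?card_ord// => i _.
  by rewrite rademacherE xk0 expr0 expr1n.
rewrite muln0; apply/eqP; have := subrX1 (rademacher R k x) (m k).
rewrite rademacher_expm subrr => /esym/eqP; rewrite mulf_eq0 subr_eq0.
by rewrite (negPf (rademacher_neq1 xk0)).
Qed.

End Rademacher.

Lemma prod_ord_widen (T : comNzRingType) (g : nat -> T) n N :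
  (n <= N)%N -> (forall k, (n <= k)%N -> g k = 1) ->
  \prod_(k < N) g k = \prod_(k < n) g k.
Proof.
move=> nN g1; rewrite -!(big_mkord xpredT) (big_cat_nat (leq0n n) nN) /=.
rewrite [X in _ * X]big_nat_cond [X in _ * X]big1 ?mulr1// => k.
by rewrite andbT => /andP[nk _]; exact: g1.
Qed.

(** * Dirichlet kernels, their partial sums, and summation by parts *)

Section Kernels.
Variables (R : realType) (m : nat -> nat).
Hypothesis m2 : forall k, (2 <= m k)%N.
Local Notation G := (vilenkin m).
Local Notation M := (vM m).
Local Notation rho := (rademacher R).
Implicit Types (x y : G) (k n A q r : nat).

Lemma vMS n : M n.+1 = (M n * m n)%N.
Proof. by rewrite /vM big_ord_recr. Qed.

Lemma vM0 : M 0 = 1%N.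
Proof. by rewrite /vM big_ord0. Qed.

Lemma vM_gt0 n : (0 < M n)%N.
Proof. by apply: leq_ltn_trans (ltn_vM m2 n). Qed.

Lemma dvdn_vM k n : (k <= n)%N -> (M k %| M n)%N.
Proof.
move=> /subnK <-; elim: (n - k)%N => // j IH.
by rewrite addSn vMS dvdn_mulr.
Qed.

Lemma vdigit_small A n k : (n < M A)%N -> (A <= k)%N -> vdigit m n k = 0%N.
Proof.
move=> nA Ak; rewrite /vdigit divn_small ?mod0n//.
exact: leq_trans nA (leq_vM m2 Ak).
Qed.

(** Cutting the product at a common level A, instead of at n, allows the digits of different indices
    to be compared factor by factor. *)
Lemma vilenkin_funE A n x : (n < M A)%N ->
  vilenkin_fun R n x = \prod_(k < A) rho k x ^+ vdigit m n k.
Proof.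
move=> nA; rewrite /vilenkin_fun.
pose g k := rho k x ^+ vdigit m n k.
transitivity (\prod_(k < maxn n A) g k); [apply/esym|];
  apply: (prod_ord_widen (g := g)); rewrite ?leq_maxl ?leq_maxr// => k hk.
- by rewrite /g vdigit_eq0.
- by rewrite /g (vdigit_small nA).
Qed.

Lemma vdigit_top A q r : (r < M A)%N -> (q < m A)%N ->
  vdigit m (q * M A + r) A = q.
Proof.
move=> rA qA; rewrite /vdigit divnMDl ?vM_gt0// (divn_small rA) addn0.
by rewrite modn_small.
Qed.

Lemma vdigit_low A q r k : (k < A)%N ->
  vdigit m (q * M A + r) k = vdigit m r k.
Proof.
move=> kA; have /dvdnP[c ->] := dvdn_vM kA.
rewrite /vdigit vMS (_ : (q * (c * (M k * m k)) = (q * c * m k) * M k)%N); last by ring.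
by rewrite divnMDl ?vM_gt0// modnMDl.
Qed.

Lemma vilenkin_fun_top A q r x : (r < M A)%N -> (q < m A)%N ->
  vilenkin_fun R (q * M A + r) x = rho A x ^+ q * vilenkin_fun R r x.
Proof.
move=> rA qA; rewrite (@vilenkin_funE A.+1); last by rewrite vMS; nia.
rewrite big_ord_recr/= vdigit_top// mulrC (vilenkin_funE _ rA); congr (_ * _).
by apply: eq_bigr => k _; rewrite vdigit_low.
Qed.

Definition dirichlet n x : R[i] := \sum_(k < n) vilenkin_fun R k x.
(** The Fejér kernel without its division by n: in this form the recursion on the leading digit
    involves no quotient. *)
Definition fejer n x : R[i] := \sum_(k < n) dirichlet k x.

Lemma dirichlet_top A q r x : (r <= M A)%N -> (q < m A)%N ->
  dirichlet (q * M A + r) x = dirichlet (q * M A) x + rho A x ^+ q * dirichlet r x.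
Proof.
move=> rA qA; rewrite /dirichlet big_split_ord /= mulr_sumr; congr (_ + _).
apply: eq_bigr => k _; rewrite vilenkin_fun_top//.
exact: leq_trans (ltn_ord k) rA.
Qed.

Lemma dirichletM A q x : (q <= m A)%N ->
  dirichlet (q * M A) x = (\sum_(j < q) rho A x ^+ j) * dirichlet (M A) x.
Proof.
elim: q => [|q IH] qA; first by rewrite /dirichlet !big_ord0 mul0r.
by rewrite mulSnr dirichlet_top// IH 1?ltnW// big_ord_recr /= mulrDl.
Qed.

(** [vcyl A] is the indicator of I_A(0) and, for s < A, [voff A s] that of the union over r of the
    I_A(r e_s). Both take values in [nat], so that the majorants can be compared by natural number
    arithmetic. *)
Definition vcyl A x : nat := \prod_(k < A) (x k == 0%R : nat).
Definition voff A s x : nat := \prod_(k < A) ((k == s :> nat) || (x k == 0%R) : nat).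

(** Each passage from M_A to M_(A+1) multiplies the kernel by a full geometric sum, that is by m_A
    1[x_A = 0]. *)
Lemma dirichlet_vM A x : dirichlet (M A) x = (M A * vcyl A x)%:R.
Proof.
elim: A => [|A IH].
  by rewrite vM0 /dirichlet big_ord_recr /= /vilenkin_fun /vcyl !big_ord0 muln1 add0r.
rewrite vMS mulnC dirichletM// sum_rademacher// IH -natrM /vcyl big_ord_recr /=.
by congr _%:R; ring.
Qed.

Lemma norm_sum_rademacher A q x : `|\sum_(j < q) rho A x ^+ j| <= q%:R.
Proof.
apply: (le_trans (ler_norm_sum _ _ _)).
under eq_bigr do rewrite normrX norm_rademacher// expr1n.
by rewrite sumr_const card_ord.
Qed.

Lemma norm_dirichletM A q x : (q <= m A)%N ->
  `|dirichlet (q * M A) x| <= (q * (M A * vcyl A x))%:R.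
Proof.
move=> qA; rewrite dirichletM// normrM dirichlet_vM normr_nat [leRHS]natrM.
by rewrite ler_wpM2r// norm_sum_rademacher.
Qed.

(** This is [dirichlet_top] summed over the lower part of the index. *)
Lemma fejer_top A q r x : (r <= M A)%N -> (q < m A)%N ->
  fejer (q * M A + r) x =
  fejer (q * M A) x + r%:R * dirichlet (q * M A) x + rho A x ^+ q * fejer r x.
Proof.
move=> rA qA; rewrite /fejer big_split_ord /= -addrA; congr (_ + _).
rewrite [X in _ = _ + X]mulr_sumr mulr_natl.
have -> : dirichlet (q * M A) x *+ r = \sum_(i < r) dirichlet (q * M A) x.
  by rewrite sumr_const card_ord.
rewrite -big_split /=.
by apply: eq_bigr => k _; rewrite dirichlet_top// ltnW// (leq_trans (ltn_ord k)).
Qed.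

Lemma fejerM A q x : (q <= m A)%N ->
  fejer (q * M A) x = (M A)%:R * (\sum_(a < q) dirichlet (a * M A) x)
                      + (\sum_(a < q) rho A x ^+ a) * fejer (M A) x.
Proof.
elim: q => [|q IH] qA; first by rewrite /fejer !big_ord0 mulr0 mul0r addr0.
by rewrite mulSnr fejer_top// IH 1?ltnW// !big_ord_recr /=; ring.
Qed.

Lemma norm_sum_dirichletM A q x : (q <= m A)%N ->
  `|\sum_(a < q) dirichlet (a * M A) x| <= (q ^ 2 * (M A * vcyl A x))%:R.
Proof.
move=> qA; apply: (le_trans (ler_norm_sum _ _ _)).
apply: (@le_trans _ _ (\sum_(a < q) (q * (M A * vcyl A x))%:R)).
  apply: ler_sum => a _; apply: le_trans (norm_dirichletM _ _) _.
    by rewrite (leq_trans _ qA)// ltnW.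
  by rewrite ler_nat leq_mul2r ltnW ?orbT.
by rewrite sumr_const card_ord -mulrnA ler_nat; nia.
Qed.

Variable B : nat.
Hypothesis mB : forall k, (m k <= B)%N.

Definition voffs A x : nat := \sum_(s < A) M s * voff A s x.

(** For s < A the new coordinate must vanish; in the new term s = A it is free, which leaves the
    indicator of I_A(0). The recursion has the same form as that of [fejer] at the indices M_A. *)
Lemma voffsS A x : voffs A.+1 x = ((x A == 0%R) * voffs A x + M A * vcyl A x)%N.
Proof.
rewrite /voffs big_ord_recr /= big_distrr /=; congr (_ + _)%N.
  apply: eq_bigr => s _; rewrite /voff big_ord_recr /=.
  by rewrite [A == s]gtn_eqF//= mulnA mulnC.
rewrite /voff big_ord_recr /= eqxx muln1; congr (_ * _)%N.
by apply: eq_bigr => k _; rewrite ltn_eqF.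
Qed.

(** By [fejerM] and [sum_rademacher], F_(M_(A+1)) is M_A times a sum of kernels D_(a M_A), supported
    in I_A(0), plus m_A 1[x_A = 0] F_(M_A). The first term accounts for the new summand in [voffsS],
    with m_A^2 <= B^2; in the second, m_A M_A = M_(A+1). *)
Lemma norm_fejer_vM A x : `|fejer (M A) x| <= (B ^ 2 * M A * voffs A x)%:R.
Proof.
elim: A => [|A IH].
  rewrite vM0 /fejer big_ord_recr big_ord0 /= /dirichlet big_ord0 addr0.
  by rewrite normr0.
have mA := mB A; have mA2 := m2 A.
rewrite {1}vMS mulnC fejerM// sum_rademacher//.
apply: (le_trans (ler_normD _ _)); rewrite !normrM !normr_nat.
apply: (@le_trans _ _ ((M A * (B ^ 2 * (M A * vcyl A x)))%:R +
   (m A * (x A == 0) * (B ^ 2 * M A * voffs A x))%:R)).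
  apply: lerD; rewrite [leRHS]natrM ler_wpM2l//.
  apply: le_trans (norm_sum_dirichletM _ _) _ => //.
  by rewrite ler_nat leq_mul2r leq_sqr mA orbT.
rewrite -natrD ler_nat voffsS vMS.
set a := nat_of_bool _; set V := voffs A x; set c := vcyl A x; set MM := M A.
have -> : (B ^ 2 * (MM * m A) * (a * V + MM * c) =
  m A * (MM * (B ^ 2 * (MM * c))) + m A * a * (B ^ 2 * MM * V))%N by ring.
by rewrite leq_add2r leq_pmull// (leq_trans _ mA2).
Qed.

(* Up to the factor M_A and a constant, |fejer (M A)| is bounded by [voffs A], while
   M_A times the Dirichlet kernel of order M_A is M_A times the second summand. *)
Definition vmaj A x : nat := (voffs A x + M A * vcyl A x)%N.

(** Split off the leading digit, n = q M_A + r. The parts of order M_A cost at most (B^2 + B) M_A^2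
    [vcyl] + B^3 M_A [voffs], which is below 2 B^3 M_A [vmaj]; the rest has modulus |F_r| and is
    left to the induction. *)
Lemma norm_fejer A n x : (n < M A)%N ->
  `|fejer n x| <= (2 * B ^ 3 * \sum_(l < A) (M l <= n) * (M l * vmaj l x))%:R.
Proof.
elim: A n => [|A IH] n nA.
  move: nA; rewrite vM0 ltnS leqn0 => /eqP ->.
  by rewrite /fejer !big_ord0 normr0 muln0.
case: (ltnP n (M A)) => [nA'|An].
  by apply: le_trans (IH _ nA') _; rewrite ler_nat leq_mul2l big_ord_recr leq_addr orbT.
pose q := (n %/ M A)%N; pose r := (n %% M A)%N.
have rA : (r < M A)%N by rewrite ltn_mod vM_gt0.
have qA : (q < m A)%N by rewrite ltn_divLR ?vM_gt0// mulnC -vMS.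
have nE : n = (q * M A + r)%N by exact: divn_eq.
rewrite {1}nE fejer_top ?(ltnW rA)// fejerM ?(ltnW qA)//.
have mA := mB A; have mA2 := m2 A.
have qB : (q <= B)%N by rewrite (leq_trans (ltnW qA)).
have Bgt0 : (0 < B)%N by rewrite (leq_trans _ mA)// (leq_trans _ mA2).
pose Sr := (\sum_(l < A) (M l <= n) * (M l * vmaj l x))%N.
(* The condition M_l <= r may be relaxed to M_l <= n, which holds for every l < A because M_A <=
   n. *)
have Fr : `|fejer r x| <= (2 * B ^ 3 * Sr)%:R.
  apply: le_trans (IH _ rA) _; rewrite ler_nat leq_mul2l; apply/orP; right.
  apply: leq_sum => l _; rewrite leq_mul2r; apply/orP; right.
  by rewrite [(M l <= n)%N](leq_trans (leq_vM m2 (ltnW (ltn_ord l))) An) leq_b1.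
apply: (@le_trans _ _ (((M A * (B ^ 2 * (M A * vcyl A x)))%:R +
   (B * (B ^ 2 * M A * voffs A x))%:R) + (M A * (B * (M A * vcyl A x)))%:R
   + (2 * B ^ 3 * Sr)%:R)).
  apply: (le_trans (ler_normD _ _)); apply: lerD.
    apply: (le_trans (ler_normD _ _)); apply: lerD.
      apply: (le_trans (ler_normD _ _)); apply: lerD.
  - rewrite normrM normr_nat [leRHS]natrM ler_wpM2l//.
    apply: le_trans (norm_sum_dirichletM _ (ltnW qA)) _.
    by rewrite ler_nat leq_mul2r leq_sqr qB orbT.
  - rewrite normrM [leRHS]natrM ler_pM// ?norm_fejer_vM//.
    by rewrite (le_trans (norm_sum_rademacher _ _ _))// ler_nat.
  - rewrite normrM normr_nat [leRHS]natrM ler_pM// ?ler_nat 1?ltnW//.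
    apply: le_trans (norm_dirichletM _ (ltnW qA)) _.
    by rewrite ler_nat leq_mul2r qB orbT.
  - by rewrite normrM normrX norm_rademacher// expr1n mul1r.
rewrite -!natrD ler_nat big_ord_recr /= -/Sr An mul1n mulnDr addnC leq_add2l.
rewrite /vmaj; set V := voffs A x; set c := vcyl A x; set MM := M A.
have B23 : (B ^ 2 <= B ^ 3)%N by rewrite leq_pexp2l.
have B13 : (B <= B ^ 3)%N by rewrite -{1}(expn1 B) leq_pexp2l.
have -> : (MM * (B ^ 2 * (MM * c)) + B * (B ^ 2 * MM * V) + MM * (B * (MM * c)) =
  (B ^ 2 + B) * (MM * MM * c) + B ^ 3 * (MM * V))%N by ring.
have -> : (2 * B ^ 3 * (MM * (V + MM * c)) =
  (B ^ 3 + B ^ 3) * (MM * MM * c) + (2 * B ^ 3) * (MM * V))%N by ring.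
by rewrite leq_add// leq_mul2r ?leq_add ?orbT// leq_pmull ?orbT.
Qed.

(** Summation by parts with D_k = F_(k+1) - F_k and 1/k - 1/(k+1) = 1/(k (k+1)), where k = i + 1 on
    the right. The lower boundary term is F_1 = D_0 = 0. *)
Lemma abel_fejer n x : \sum_(1 <= k < n.+2) dirichlet k x / k%:R =
  fejer n.+2 x / n.+1%:R +
  \sum_(i < n) fejer i.+2 x / (i.+2%:R * i.+1%:R).
Proof.
have fS k : fejer k.+1 x = fejer k x + dirichlet k x by rewrite /fejer big_ord_recr.
elim: n => [|n IH].
  rewrite big_nat1 big_ord0 addr0 !divr1 fS /fejer big_ord_recr big_ord0 /=.
  by rewrite /dirichlet big_ord0 !add0r.
rewrite big_nat_recr//= IH big_ord_recr /= [in RHS]fS.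
rewrite -addrA [in RHS](addrC (\sum_(i < n) _)) [in RHS]addrA.
rewrite [LHS]addrCA [in RHS]addrC; congr (_ + _).
have h1 : n.+1%:R != 0 :> R[i] by rewrite pnatr_eq0.
have h2 : n.+2%:R != 0 :> R[i] by rewrite pnatr_eq0.
by move: h1 h2; rewrite -![n.+2%:R]natr1 -![n.+1%:R]natr1 => h1 h2; field; rewrite h1 h2.
Qed.

(** Total weight that [abel_fejer] puts on the indices k >= N. Once N <= n + 2 it no longer depends
    on n, by telescoping; it equals 1/(N-1), or 1 if N = 1, and both are at most 2/N. *)
Lemma abel_weight (K : numFieldType) (N n : nat) : (0 < N)%N ->
  (N <= n.+2)%N%:R / n.+1%:R + \sum_(i < n) (N <= i.+2)%N%:R / (i.+2%:R * i.+1%:R)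
  <= 2 / N%:R :> K.
Proof.
move=> N0; elim: n => [|n IH].
  rewrite big_ord0 addr0 divr1; case: leqP => N2; last by rewrite divr_ge0.
  by rewrite ler_pdivlMr ?ltr0n// mul1r ler_nat.
case: (leqP N n.+2) => Nn.
  move: IH; rewrite big_ord_recr/= Nn (leq_trans Nn)//=.
  apply: le_trans; rewrite addrCA addrC lerD2r.
  have h1 : n.+1%:R != 0 :> K by rewrite pnatr_eq0.
  have h2 : n.+2%:R != 0 :> K by rewrite pnatr_eq0.
  rewrite le_eqVlt; apply/orP; left; apply/eqP.
  by move: h1 h2; rewrite -![n.+2%:R]natr1 -![n.+1%:R]natr1 => h1 h2; field; rewrite h1 h2.
rewrite big1 ?addr0; last first.
  by move=> i _; rewrite leqNgt (leq_trans _ Nn) ?mul0r//= !ltnS -ltnS ltn_ord.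
case: leqP => Nn2; last by rewrite mul0r divr_ge0.
have -> : N = n.+3 by apply/eqP; rewrite eqn_leq Nn2.
rewrite mul1r ler_pdivlMr ?ltr0n// mulrC ler_pdivrMr ?ltr0n//.
by rewrite -natrM ler_nat; lia.
Qed.

(** After exchanging the sums, level l carries the factor M_l from [norm_fejer] and the weight 2 /
    M_l from [abel_weight]. The factors M_l cancel, and 4 is 2 times 2. *)
Lemma norm_sum_dirichlet A n x : (2 <= n)%N -> (n < M A)%N ->
  `|\sum_(1 <= k < n) dirichlet k x / k%:R| <=
  (4 * B ^ 3 * \sum_(l < A) vmaj l x)%:R.
Proof.
case: n => [//|[//|n]] _ nA; rewrite abel_fejer.
apply: (le_trans (ler_normD _ _)).
pose c l := (2 * B ^ 3 * (M l * vmaj l x))%N.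
have Fb k : (k <= n.+2)%N ->
    `|fejer k x| <= \sum_(l < A) (M l <= k)%N%:R * (c l)%:R.
  move=> kn; apply: le_trans (norm_fejer _ (leq_ltn_trans kn nA)) _.
  rewrite natrM natr_sum mulr_sumr; apply: ler_sum => l _.
  by rewrite -!natrM ler_nat /c; nia.
apply: (@le_trans _ _ (\sum_(l < A) (c l)%:R * (2 / (M l)%:R))).
  apply: (@le_trans _ _ (\sum_(l < A) (c l)%:R * ((M l <= n.+2)%N%:R / n.+1%:R +
      \sum_(i < n) (M l <= i.+2)%N%:R / (i.+2%:R * i.+1%:R)))); last first.
    by apply: ler_sum => l _; rewrite ler_wpM2l// abel_weight// vM_gt0.
  under [leRHS]eq_bigr do rewrite mulrDr.
  rewrite big_split /=; apply: lerD.
    rewrite normrM normfV normr_nat.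
    under eq_bigr do rewrite mulrA.
    rewrite -mulr_suml ler_wpM2r ?invr_ge0//.
    by apply: le_trans (Fb _ (leqnn _)) _; under eq_bigr do rewrite mulrC.
  apply: (le_trans (ler_norm_sum _ _ _)).
  under [leRHS]eq_bigr do rewrite mulr_sumr.
  rewrite exchange_big /=; apply: ler_sum => i _.
  rewrite normrM normfV -natrM normr_nat.
  under eq_bigr do rewrite mulrA.
  rewrite -mulr_suml ler_wpM2r ?invr_ge0//.
  have ii : (i.+2 <= n.+2)%N by rewrite !ltnS ltnW.
  by apply: le_trans (Fb _ ii) _; under eq_bigr do rewrite mulrC.
rewrite natrM natr_sum mulr_sumr; apply: ler_sum => l _.
have Ml : (M l)%:R != 0 :> R[i] by rewrite pnatr_eq0 -lt0n vM_gt0.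
rewrite /c; move: (B ^ 3)%N => b; rewrite !natrM.
by rewrite le_eqVlt; apply/orP; left; apply/eqP; field.
Qed.

End Kernels.

(** * Topology and measurability through cylinders *)

Section Cylinders.
Variable m : nat -> nat.
Local Notation G := (vilenkin m).
Implicit Types (x y t : G) (A k : nat).

Lemma vcylinder_sym A x y : vcylinder A x y -> vcylinder A y x.
Proof. by move=> h k kA; rewrite h. Qed.

Lemma vcylinder_trans A x y t :
  vcylinder A x y -> vcylinder A y t -> vcylinder A x t.
Proof. by move=> h h' k kA; rewrite h' ?h. Qed.

Lemma vcylinder_le A A' x : (A <= A')%N -> vcylinder A' x `<=` vcylinder A x.
Proof. by move=> AA' y h k kA; rewrite h// (leq_trans kA). Qed.

Lemma vcylinderS A x : vcylinder A.+1 x = vcylinder A x `&` [set y | y A = x A].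
Proof.
apply/seteqP; split=> y /=.
  by move=> h; split=> [k kA|]; apply: h; rewrite // ltnW.
by move=> [h e] k; rewrite ltnS leq_eqVlt => /orP[/eqP->//|]; exact: h.
Qed.

Lemma nbhs_vcylinder A x : nbhs x (vcylinder A x).
Proof.
elim: A => [|A IH]; first by apply: filterS filterT => y _ k.
rewrite vcylinderS; apply: filterI => //.
have := @proj_continuous nat (fun k => discrete_topology 'Z_(m k)) A x.
move=> /(_ [set a | a = x A]); apply.
by rewrite /nbhs /=.
Qed.

Lemma open_vcylinderP (U : set G) :
  open U <-> forall x, U x -> exists A, vcylinder A x `<=` U.
Proof.
split=> [oU x Ux|h]; last first.
  rewrite openE => x /h [A AU]; rewrite /interior.
  exact: filterS AU (nbhs_vcylinder A x).
pose F := filter_from [set: nat] (fun A => vcylinder A x).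
have FF : Filter F.
  apply: filter_from_filter; first by exists 0%N.
  move=> i j _ _; exists (maxn i j) => // y h.
  by split; apply: vcylinder_le h; rewrite ?leq_maxl ?leq_maxr.
(* The product topology is the supremum of the topologies induced by the coordinates, so convergence
   is checked one coordinate at a time; level k + 1 fixes coordinate k. *)
have Fx : F --> (x : sup_topology (fun i => Topological.class
    (initial_topology (fun f : (forall i, discrete_topology 'Z_(m i)) => f i)))).
  apply/cvg_sup => k V.
  rewrite (@nbhsE (initial_topology
    (fun f : (forall i, discrete_topology 'Z_(m i)) => f k))) => - [D [[W oW WD] Dx] DV].
  exists k.+1 => // y h; apply: DV.
  by move: Dx; rewrite -WD /= h.
have [A _ AU] : F U by apply: Fx; exact: open_nbhs_nbhs.
by exists A.
Qed.

(** Such a set is open, being a union of cylinders of level A. *)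
Lemma measurable_vcyl_inv A (V : set G) :
  (forall x y, V x -> vcylinder A x y -> V y) -> measurable V.
Proof.
move=> h; apply: sub_sigma_algebra; apply/open_vcylinderP => x Vx.
by exists A => y; exact: h.
Qed.

Lemma measurable_vcylinder A x : measurable (vcylinder A x).
Proof. by apply: (@measurable_vcyl_inv A) => y z; exact: vcylinder_trans. Qed.

Lemma measurable_fun_vcyl d (T : measurableType d) A (f : G -> T) :
  (forall x y, vcylinder A x y -> f y = f x) -> measurable_fun setT f.
Proof.
move=> h _ Y _; rewrite setTI; apply: (@measurable_vcyl_inv A) => x y /=.
by move=> Yx /h ->.
Qed.

Let code A x : nat := pickle [seq (x k : nat) | k <- iota 0 A].

Let codeP A x y : code A x = code A y -> vcylinder A x y.
Proof.
move=> /(pcan_inj pickleK) /eq_in_map h k kA.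
by apply/val_inj/esym/h; rewrite mem_iota.
Qed.

Let codeE A x y : vcylinder A x y -> code A x = code A y.
Proof.
move=> h; congr pickle; apply/eq_in_map => k; rewrite mem_iota add0n => kA.
by rewrite (h k kA).
Qed.

(* Classes modulo cylinders of level A are countably many, so a set which is a
   union of products of such classes is a countable union of rectangles.       *)
Lemma measurable_fun_vcyl2 d (T : measurableType d) A (f : G * G -> T) :
  (forall x y x' y', vcylinder A x x' -> vcylinder A y y' -> f (x', y') = f (x, y)) ->
  measurable_fun setT f.
Proof.
move=> h _ Y _; rewrite setTI.
pose S i j := exists x y, [/\ code A x = i, code A y = j & Y (f (x, y))].
pose C i := [set x | code A x = i].
have mC i : measurable (C i).
  by apply: (@measurable_vcyl_inv A) => x y /= <- /codeE.
rewrite (_ : _ @^-1` _ =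
    \bigcup_i \bigcup_j if `[< S i j >] then C i `*` C j else set0); last first.
  apply/seteqP; split=> [[x y] /= Yxy|[x y] [i _ [j _]]].
    exists (code A x) => //; exists (code A y) => //.
    by case: asboolP => // -[]; exists x, y.
  case: asboolP => // -[x' [y' [x'i y'j Yf]]] [/= xi yj].
  by rewrite (h x' y')//; apply: codeP; rewrite ?x'i ?y'j.
apply: bigcupT_measurable => i; apply: bigcupT_measurable => j.
by case: asboolP => _; [exact: measurableX|exact: measurable0].
Qed.

Lemma measurable_vtranslation (u : G) : measurable_fun setT (fun x : G => u + x).
Proof.
apply: (@measurability _ _ _ _ _ _ (@open G)) => //.
move=> _ [U oU <-]; rewrite setTI; apply: sub_sigma_algebra.
apply/open_vcylinderP => x /= Ux.
have [A AU] := (open_vcylinderP U).1 oU _ Ux.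
by exists A => y h; apply: AU => k kA; congr (_ + _); exact: h.
Qed.

End Cylinders.

(** * Modulus, measurability and integration of complex functions *)

Section NormcInequalities.
Variable R : realType.
Implicit Types z : R[i].
Local Notation normc := (@ComplexField.Normc.normc R).

Lemma normc_ge0 z : 0 <= normc z.
Proof. by case: z => a b; exact: sqrtr_ge0. Qed.

Lemma complex_normE z : `|z| = (normc z)%:C%C.
Proof. by case: z => a b; rewrite normc_def. Qed.

Lemma ge_Re_normc z : `|complex.Re z| <= normc z.
Proof.
case: z => a b /=; rewrite -sqrtr_sqr ler_wsqrtr// lerDl; exact: sqr_ge0.
Qed.

Lemma ge_Im_normc z : `|complex.Im z| <= normc z.
Proof.
case: z => a b /=; rewrite -sqrtr_sqr ler_wsqrtr// lerDr; exact: sqr_ge0.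
Qed.

Lemma le_normc_ReIm z : normc z <= `|complex.Re z| + `|complex.Im z|.
Proof.
case: z => a b /=.
rewrite -[leRHS]ger0_norm ?addr_ge0// -sqrtr_sqr ler_wsqrtr// sqrrD.
by rewrite !real_normK ?num_real// lerD2r lerDl mulrn_wge0// mulr_ge0.
Qed.

End NormcInequalities.

Section ComplexIntegral.
Context d (T : measurableType d) (R : realType).
Variable mu : {measure set T -> \bar R}.
Implicit Types (f g : T -> R[i]) (c : R[i]).
Local Notation normc := (@ComplexField.Normc.normc R).

Definition cmeasurable f := measurable_fun setT (fun t => complex.Re (f t)) /\
  measurable_fun setT (fun t => complex.Im (f t)).

Definition cintegrable f :=
  mu.-integrable setT (fun t => (complex.Re (f t))%:E) /\
  mu.-integrable setT (fun t => (complex.Im (f t))%:E).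

Lemma cintegrable_measurable f : cintegrable f -> cmeasurable f.
Proof.
by move=> [/integrableP[/measurable_EFinP mr _] /integrableP[/measurable_EFinP mi _]].
Qed.

Lemma cmeasurableD f g :
  cmeasurable f -> cmeasurable g -> cmeasurable (fun t => f t + g t).
Proof.
move=> [fr fi] [gr gi]; split.
  under eq_fun do rewrite raddfD.
  exact: measurable_funD.
under eq_fun do rewrite raddfD.
exact: measurable_funD.
Qed.

Lemma ReM (z w : R[i]) : complex.Re (z * w) =
  complex.Re z * complex.Re w - complex.Im z * complex.Im w.
Proof. by case: z => a b; case: w. Qed.

Lemma ImM (z w : R[i]) : complex.Im (z * w) =
  complex.Re z * complex.Im w + complex.Im z * complex.Re w.
Proof. by case: z => a b; case: w. Qed.

Lemma cmeasurableM f g :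
  cmeasurable f -> cmeasurable g -> cmeasurable (fun t => f t * g t).
Proof.
move=> [fr fi] [gr gi]; split.
  under eq_fun do rewrite ReM.
  by apply: measurable_funB; apply: measurable_funM.
under eq_fun do rewrite ImM.
by apply: measurable_funD; apply: measurable_funM.
Qed.

Lemma cmeasurable_cst c : cmeasurable (fun=> c).
Proof. by split; exact: measurable_cst. Qed.

Lemma cmeasurable_sum I (s : seq I) (F : I -> T -> R[i]) :
  (forall i, cmeasurable (F i)) -> cmeasurable (fun t => \sum_(i <- s) F i t).
Proof.
move=> mF; elim: s => [|i s IH].
  by under eq_fun do rewrite big_nil; exact: cmeasurable_cst.
by under eq_fun do rewrite big_cons; exact: cmeasurableD.
Qed.

Lemma measurable_normc f : cmeasurable f -> measurable_fun setT (fun t => normc (f t)).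
Proof.
move=> [fr fi].
have -> : (fun t => normc (f t)) = Num.sqrt \o
    (fun t => complex.Re (f t) ^+ 2 + complex.Im (f t) ^+ 2).
  by apply/funext => t /=; case: (f t).
apply: measurableT_comp.
  exact: (continuous_measurable_fun (@sqrt_continuous R)).
by apply: measurable_funD; exact: measurable_funX.
Qed.

Lemma cintegrableP f : cmeasurable f ->
  mu.-integrable setT (fun t => (normc (f t))%:E) -> cintegrable f.
Proof.
move=> [fr fi] fn; split; apply: le_integrable fn => //.
- exact/measurable_EFinP.
- by move=> t _ /=; rewrite lee_fin [leRHS]ger0_norm ?normc_ge0// ge_Re_normc.
- exact/measurable_EFinP.
- by move=> t _ /=; rewrite lee_fin [leRHS]ger0_norm ?normc_ge0// ge_Im_normc.
Qed.

Lemma cintegrable_normc f : cintegrable f ->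
  mu.-integrable setT (fun t => (normc (f t))%:E).
Proof.
move=> fint; have [fr fi] := fint.
apply: (@le_integrable _ _ _ mu _ _ _ ((abse \o (fun t => (complex.Re (f t))%:E)) \+
   (abse \o (fun t => (complex.Im (f t))%:E)))%E) => //.
- by apply/measurable_EFinP/measurable_normc/cintegrable_measurable.
- move=> t _ /=; rewrite lee_fin ger0_norm ?normc_ge0//.
  by rewrite [leRHS]ger0_norm ?addr_ge0// le_normc_ReIm.
- by apply: integrableD => //; apply: integrable_abse.
Qed.

Lemma cintegrableM f g (b : R) : cintegrable f -> cmeasurable g ->
  (forall t, normc (g t) <= b) -> cintegrable (fun t => f t * g t).
Proof.
move=> fint mg gb; have mf := cintegrable_measurable fint.
apply: cintegrableP; first exact: cmeasurableM.
apply: (@le_integrable _ _ _ mu _ _ _ (fun t => b%:E * (normc (f t))%:E)%E) => //.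
- by apply/measurable_EFinP/measurable_normc/cmeasurableM.
- move=> t _ /=; rewrite lee_fin ComplexField.Normc.normcM mulrC.
  rewrite !ger0_norm ?mulr_ge0 ?normc_ge0// ?(le_trans (normc_ge0 _) (gb t))//.
  by rewrite ler_wpM2r ?normc_ge0.
- by apply: integrableZl => //; exact: cintegrable_normc.
Qed.

Lemma cintegrableD f g : cintegrable f -> cintegrable g ->
  cintegrable (fun t => f t + g t).
Proof.
move=> [fr fi] [gr gi]; split.
  under eq_fun do rewrite raddfD EFinD.
  exact: integrableD.
under eq_fun do rewrite raddfD EFinD.
exact: integrableD.
Qed.

Lemma complex_integralD f g : cintegrable f -> cintegrable g ->
  complex_integral mu (fun t => f t + g t) =
  complex_integral mu f + complex_integral mu g.
Proof.
move=> [fr fi] [gr gi]; apply/eqP; rewrite eq_complex /=; apply/andP; split.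
  under eq_Rintegral do rewrite raddfD.
  by rewrite RintegralD.
under eq_Rintegral do rewrite raddfD.
by rewrite RintegralD.
Qed.

Let integrableZl_real (k : R) (h : T -> R) : mu.-integrable setT (EFin \o h) ->
  mu.-integrable setT (EFin \o (fun x => k * h x)).
Proof. by move=> /(integrableZl measurableT k); apply: eq_integrable. Qed.

Lemma complex_integralZ c f : cintegrable f ->
  complex_integral mu (fun t => c * f t) = c * complex_integral mu f.
Proof.
move=> [fr fi]; apply/eqP; rewrite eq_complex ReM ImM /=; apply/andP; split.
  under eq_Rintegral do rewrite ReM.
  rewrite RintegralB//; [|exact: integrableZl_real..].
  by rewrite !RintegralZl.
under eq_Rintegral do rewrite ImM.
rewrite RintegralD//; [|exact: integrableZl_real..].
by rewrite !RintegralZl.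
Qed.

Lemma cintegrableZ c f : cintegrable f -> cintegrable (fun t => c * f t).
Proof.
move=> [fr fi]; split.
  under eq_fun do rewrite ReM EFinB.
  by apply: integrableB => //; exact: integrableZl_real.
under eq_fun do rewrite ImM EFinD.
by apply: integrableD => //; exact: integrableZl_real.
Qed.

Lemma complex_integral0 : complex_integral mu (fun=> 0) = 0 :> R[i].
Proof. by rewrite /complex_integral /= /Rintegral integral0. Qed.

Lemma cintegrable0 : cintegrable (fun=> 0).
Proof. by split; exact: integrable0. Qed.

Lemma cintegrable_sum I (s : seq I) (F : I -> T -> R[i]) :
  (forall i, cintegrable (F i)) -> cintegrable (fun t => \sum_(i <- s) F i t).
Proof.
move=> mF; elim: s => [|i s IH].
  by under eq_fun do rewrite big_nil; exact: cintegrable0.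
by under eq_fun do rewrite big_cons; exact: cintegrableD.
Qed.

Lemma complex_integral_sum I (s : seq I) (F : I -> T -> R[i]) :
  (forall i, cintegrable (F i)) ->
  complex_integral mu (fun t => \sum_(i <- s) F i t) =
  \sum_(i <- s) complex_integral mu (F i).
Proof.
move=> mF; elim: s => [|i s IH].
  by under eq_fun do rewrite big_nil; rewrite big_nil complex_integral0.
rewrite big_cons -IH -complex_integralD//; last exact: cintegrable_sum.
by congr complex_integral; apply/funext => t; rewrite big_cons.
Qed.

(** Real and imaginary parts are estimated separately, which costs the factor 2 and avoids a
    rotation argument. *)
Lemma normc_complex_integral f : cintegrable f ->
  ((normc (complex_integral mu f))%:E <= 2%:E * \int[mu]_t (normc (f t))%:E)%E.
Proof.
move=> fint; have [fr fi] := fint; have fn := cintegrable_normc fint.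
have nfin := integrable_fin_num measurableT fn.
rewrite -(fineK nfin) -EFinM lee_fin.
apply: (le_trans (le_normc_ReIm _)); rewrite mulr_natl mulr2n.
apply: lerD => /=.
  apply: (le_trans (le_normr_Rintegral _ _)) => //.
  apply: le_Rintegral => //; first exact: (integrable_norm fr).
  by move=> t _; exact: ge_Re_normc.
apply: (le_trans (le_normr_Rintegral _ _)) => //.
apply: le_Rintegral => //; first exact: (integrable_norm fi).
by move=> t _; exact: ge_Im_normc.
Qed.

End ComplexIntegral.

(** * Translation invariance and the measure of cylinders *)

Section HaarMeasure.
Variables (R : realType) (m : nat -> nat).
Hypothesis m2 : forall k, (2 <= m k)%N.
Local Notation G := (vilenkin m).
Variable mu : probability G R.
Hypothesis hmu : haar mu.
Implicit Types (x y t u : G) (A k s l : nat).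
Local Notation M := (vM m).

(** [haar] speaks of images; a preimage under translation by u is the image under translation by -u.
    Preimages are what the change of variables needs. *)
Lemma mu_vtranslation u (B : set G) : measurable B ->
  mu ((fun t => u + t) @^-1` B) = mu B.
Proof.
move=> mB; rewrite -(hmu (- u) mB); congr (mu _).
apply/seteqP; split=> [t /= But|t [y By <-]] /=; last by rewrite addNKr.
by exists (u + t) => //; rewrite addKr.
Qed.

Lemma integrable_vtranslation_integral u (g : G -> R) :
  mu.-integrable setT (fun t => (g (u + t))%:E) ->
  measurable_fun setT g ->
  (\int[mu]_t g (u + t) = \int[mu]_t g t)%R.
Proof.
move=> ig mg; rewrite /Rintegral; congr fine.
pose phi := fun t : G => u + t.
have mphi : measurable_fun setT phi by exact: measurable_vtranslation.
rewrite -(@integral_pushforward _ _ _ _ _ phi mphi mu setT (EFin \o g))//; last first.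
  exact/measurable_EFinP.
apply: eq_measure_integral => B mB _.
exact: mu_vtranslation.
Qed.

Lemma vunitMn s r k : (vunit m s *+ r) k = if k == s then r%:R else 0.
Proof.
elim: r => [|r IH]; first by rewrite !mulr0n; case: ifP.
rewrite !mulrS -[LHS]/(vunit m s k + (vunit m s *+ r) k) IH /vunit.
by case: eqP => // _; rewrite add0r.
Qed.

Lemma mu_vcylinder0 A x : mu (vcylinder A x) = mu (vcylinder A (0 : G)).
Proof.
rewrite -(mu_vtranslation (- x) (measurable_vcylinder A 0)); congr (mu _).
apply/seteqP; split=> y /= h k kA.
  by rewrite -[LHS]/(- x k + y k) h// addNr.
by have /= := h k kA; rewrite -[LHS]/(- x k + y k) => /eqP; rewrite addrC subr_eq0 => /eqP.
Qed.

(** I_A(0) is the disjoint union of the m_A cylinders I_(A+1)(r e_A), all translates of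
    I_(A+1)(0). *)
Lemma mu_vcylinderS A : mu (vcylinder A (0 : G)) =
  ((m A)%:R%:E * mu (vcylinder A.+1 (0%R : G)))%E.
Proof.
pose F (r : nat) : set G := vcylinder A.+1 (vunit m A *+ r).
have -> : vcylinder A (0 : G) = \big[setU/set0]_(r < m A) F r.
  rewrite -bigcup_mkord; apply/seteqP; split=> [y h|y [r /= rA]].
    exists (y A : nat) => /=.
      by have := ltn_ord (y A); rewrite [X in (_ < X)%N]Zp_cast.
    move=> k; rewrite ltnS leq_eqVlt vunitMn => /orP[/eqP->|kA].
      by rewrite eqxx natr_Zp.
    by rewrite ltn_eqF// (h k kA).
  move=> h k kA; rewrite h ?(ltnW kA)//; last by rewrite ltnS ltnW.
  by rewrite vunitMn ltn_eqF.
rewrite measure_bigsetU_ord; last 2 first.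
- by move=> r; exact: measurable_vcylinder.
- move=> i j /= _ _ [y [hi hj]]; apply/val_inj.
  have := hi A (ltnSn A); rewrite hj// !vunitMn eqxx => /(congr1 val) /=.
  by rewrite !val_Zp_nat// !modn_small.
rewrite (eq_bigr (fun=> mu (vcylinder A.+1 (0 : G)))); last first.
  by move=> r _; exact: mu_vcylinder0.
by rewrite sumr_const card_ord mule_natl.
Qed.

Lemma mu_vcylinder A x : mu (vcylinder A x) = ((M A)%:R^-1)%:E.
Proof.
rewrite mu_vcylinder0; elim: A => [|A IH].
  rewrite vM0 invr1 (_ : vcylinder 0 _ = setT) ?probability_setT//.
  by apply/seteqP; split.
have := mu_vcylinderS A; rewrite IH => h.
have fin : mu (vcylinder A.+1 (0 : G)) \is a fin_num.
  by apply: fin_num_measure; exact: measurable_vcylinder.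
move: h; rewrite -(fineK fin) -EFinM => -[h]; congr EFin.
have mA : (m A)%:R != 0 :> R by rewrite pnatr_eq0 -lt0n (leq_trans _ (m2 A)).
by rewrite vMS natrM invfM h mulrC mulKf.
Qed.

End HaarMeasure.

(** * Riesz means as integrals against a kernel *)

Section KernelRepresentation.
Variables (R : realType) (m : nat -> nat).
Hypothesis m2 : forall k, (2 <= m k)%N.
Local Notation G := (vilenkin m).
Variable mu : probability G R.
Hypothesis hmu : haar mu.
Implicit Types (x y t u : G) (A k s l n : nat) (f g : G -> R[i]).
Local Notation M := (vM m).
Local Notation normc := (@ComplexField.Normc.normc R).
Local Notation psi := (vilenkin_fun R).

Lemma vilenkin_funD n x y : psi n (x + y) = psi n x * psi n y.
Proof.
rewrite /vilenkin_fun -big_split /=; apply: eq_bigr => k _.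
by rewrite rademacherD// exprMn.
Qed.

Lemma vilenkin_funN n x : psi n (- x) = conjc (psi n x).
Proof.
rewrite /vilenkin_fun rmorph_prod /=; apply: eq_bigr => k _.
by rewrite rademacherN// rmorphXn.
Qed.

Lemma vilenkin_fun0 x : psi 0 x = 1.
Proof. by rewrite /vilenkin_fun big_ord0. Qed.

Lemma normc_vilenkin_fun n x : normc (psi n x) = 1.
Proof.
have : `|psi n x| = 1.
  rewrite /vilenkin_fun normr_prod big1// => k _.
  by rewrite normrX norm_rademacher// expr1n.
by rewrite complex_normE => -[].
Qed.

Lemma vilenkin_fun_vcylinder n x y : vcylinder n x y -> psi n y = psi n x.
Proof.
move=> h; rewrite /vilenkin_fun; apply: eq_bigr => k _.
by rewrite /rademacher (h k (ltn_ord k)).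
Qed.

Lemma vcylinder_subl n x y z : vcylinder n y z -> vcylinder n (x - y) (x - z).
Proof. by move=> h k kn; congr (_ - _); exact: h. Qed.

Lemma cmeasurable_vcyl n f :
  (forall y z, vcylinder n y z -> f z = f y) -> cmeasurable f.
Proof.
by move=> h; split; apply: (@measurable_fun_vcyl _ _ _ n) => y z /h ->.
Qed.

Lemma cmeasurable_vilenkin_fun n x : cmeasurable (fun t => psi n (x - t)).
Proof.
apply: (@cmeasurable_vcyl n) => y z h; apply: vilenkin_fun_vcylinder.
exact: vcylinder_subl.
Qed.

Lemma cintegrable_bounded f (b : R) : cmeasurable f ->
  (forall t, normc (f t) <= b) -> cintegrable mu f.
Proof.
move=> mf fb.
have c1 : cintegrable mu (fun=> 1 : R[i]).
  by split; [exact: (finite_measure_integrable_cst mu 1)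
            |exact: (finite_measure_integrable_cst mu 0)].
by have := cintegrableM c1 mf fb; under eq_fun do rewrite mul1r.
Qed.

Lemma cintegrable_vilenkin_fun n x : cintegrable mu (fun t => psi n (x - t)).
Proof.
apply: (@cintegrable_bounded _ 1); first exact: cmeasurable_vilenkin_fun.
by move=> t; rewrite normc_vilenkin_fun.
Qed.

(** Some digit n_s is nonzero, and at e_s only the factor s survives: it is r_s(e_s)^(n_s) = r_s(n_s
    e_s), different from 1 as 0 < n_s < m_s. *)
Lemma vilenkin_fun_neq1 n : (0 < n)%N -> exists u : G, psi n u != 1.
Proof.
move=> n0.
have [s ns] : exists s, vdigit m n s != 0%N.
  apply: contrapT => /forallNP h; move: n0; rewrite (vdigitE m2 n) big1// => k _.
  by have /negP := h k; rewrite negbK => /eqP ->.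
have sn : (s < n)%N.
  by rewrite ltnNge; apply: contra ns => /(vdigit_eq0 m2) ->.
exists (vunit m s).
rewrite /vilenkin_fun (bigD1 (Ordinal sn))//= big1 ?mulr1; last first.
  move=> k; rewrite -val_eqE /= => /negPf ks.
  by rewrite rademacherE// /vunit ks expr0 expr1n.
have dE : ((vunit m s *+ vdigit m n s) s : nat) = vdigit m n s.
  by rewrite vunitMn eqxx val_Zp_nat// modn_small// vdigit_lt.
have -> : rademacher R s (vunit m s) ^+ vdigit m n s =
    rademacher R s (vunit m s *+ vdigit m n s).
  elim: (vdigit m n s) => [|d IH]; first by rewrite mulr0n rademacher0.
  by rewrite exprS mulrS rademacherD// IH.
by apply: rademacher_neq1 => //; rewrite -val_eqE /= dE.
Qed.

Lemma complex_integral_vtranslation u f : cintegrable mu (fun t => f (u + t)) ->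
  cmeasurable f ->
  complex_integral mu (fun t => f (u + t)) = complex_integral mu f.
Proof.
move=> [fr fi] [mr mi]; rewrite /complex_integral.
rewrite (integrable_vtranslation_integral hmu (g := fun t => complex.Re (f t)))//.
by rewrite (integrable_vtranslation_integral hmu (g := fun t => complex.Im (f t))).
Qed.

(** Translating by u leaves the integral unchanged but multiplies it by psi_n(u). With u chosen so
    that psi_n(u) differs from 1, the integral must vanish. *)
Lemma integral_vilenkin_fun n x :
  complex_integral mu (fun t => psi n (x - t)) = (n == 0%N)%:R.
Proof.
have iphi := cintegrable_vilenkin_fun n x.
case: eqP => [->|/eqP n0].
  under eq_fun do rewrite vilenkin_fun0.
  rewrite /complex_integral /= Rintegral_cst// Rintegral_cst//.
  have muT : fine (mu setT) = 1 :> R by rewrite probability_setT.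
  by rewrite mul1r mul0r; congr Complex; exact: muT.
have [u u1] : exists u : G, psi n u != 1 by apply: vilenkin_fun_neq1; rewrite lt0n.
apply/eqP; set I := complex_integral _ _.
have e t : psi n (x - (- u + t)) = psi n u * psi n (x - t).
  by rewrite -vilenkin_funD; congr (psi n _); rewrite opprD opprK addrCA.
have : psi n u * I = I.
  rewrite -complex_integralZ//.
  under eq_fun do rewrite -e.
  apply: (@complex_integral_vtranslation (- u) (fun t => psi n (x - t))).
    by under eq_fun do rewrite e; exact: cintegrableZ.
  exact: cintegrable_measurable iphi.
move=> /eqP; rewrite -subr_eq0 -{2}[I]mul1r -mulrBl mulf_eq0 subr_eq0.
by rewrite (negPf u1).
Qed.

Lemma cintegrableM_vilenkin n x f : cintegrable mu f ->
  cintegrable mu (fun t => f t * psi n (x - t)).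
Proof.
move=> fint; apply: (cintegrableM (b := 1)) => //.
  exact: cmeasurable_vilenkin_fun.
by move=> t; rewrite normc_vilenkin_fun.
Qed.

Lemma fourier_coefE n x f : cintegrable mu f ->
  fourier_coef mu f n * psi n x = complex_integral mu (fun t => f t * psi n (x - t)).
Proof.
move=> fint.
have iconj : cintegrable mu (fun t => f t * conjc (psi n t)).
  have := cintegrableM_vilenkin n 0 fint.
  by under eq_fun do rewrite sub0r vilenkin_funN.
rewrite mulrC -complex_integralZ//.
congr complex_integral; apply/funext => t.
by rewrite vilenkin_funD vilenkin_funN mulrCA.
Qed.

Lemma cintegrable_cst c : cintegrable mu (fun=> c : R[i]).
Proof.
by apply: (@cintegrable_bounded _ (normc c)) => //; exact: cmeasurable_cst.
Qed.

Lemma cintegrableBcst f c : cintegrable mu f -> cintegrable mu (fun t => f t - c).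
Proof. by move=> fint; apply: cintegrableD => //; exact: cintegrable_cst. Qed.

(** For n > 0 the kernel D_n has integral 1, all of it coming from the index 0, so f(x) can be moved
    under the integral. *)
Lemma fourier_sumE n x f : cintegrable mu f -> (0 < n)%N ->
  fourier_sum mu n f x =
  complex_integral mu (fun t => (f t - f x) * dirichlet R n (x - t)) + f x.
Proof.
move=> fint n0; rewrite /fourier_sum /dirichlet.
under eq_bigr do rewrite fourier_coefE//.
have -> : (fun t => (f t - f x) * \sum_(k < n) psi k (x - t)) =
    (fun t => \sum_(k < n) (f t - f x) * psi k (x - t)).
  by apply/funext => t; rewrite mulr_sumr.
have gint := cintegrableBcst (f x) fint.
rewrite complex_integral_sum; last by move=> k; exact: (cintegrableM_vilenkin k x gint).
have fxE : f x = \sum_(k < n) f x * (k == 0 :> nat)%:R.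
  rewrite (bigD1 (Ordinal n0))//= mulr1 big1 ?addr0// => k.
  by rewrite -val_eqE /= => /negPf ->; rewrite mulr0.
rewrite [X in _ = _ + X]fxE -big_split /=; apply: eq_bigr => k _.
rewrite -(integral_vilenkin_fun k x) -complex_integralZ; last exact: cintegrable_vilenkin_fun.
rewrite -complex_integralD; last 2 first.
- exact: (cintegrableM_vilenkin k x gint).
- exact/cintegrableZ/cintegrable_vilenkin_fun.
by congr complex_integral; apply/funext => t; rewrite mulrBl subrK.
Qed.

Definition riesz_kernel n y : R[i] := \sum_(1 <= k < n) dirichlet R k y / k%:R.

Lemma cmeasurable_riesz_kernel n x : cmeasurable (fun t => riesz_kernel n (x - t)).
Proof.
apply: cmeasurable_sum => k; apply: cmeasurableM; last exact: cmeasurable_cst.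
by apply: cmeasurable_sum => j; exact: cmeasurable_vilenkin_fun.
Qed.

Lemma cmeasurable_riesz_mean n f : cmeasurable (riesz_mean mu n f).
Proof.
apply: cmeasurableM; first exact: cmeasurable_cst.
apply: cmeasurable_sum => k; apply: cmeasurableM; last exact: cmeasurable_cst.
apply: cmeasurable_sum => j; apply: cmeasurableM; first exact: cmeasurable_cst.
by apply: (@cmeasurable_vcyl j) => y z; exact: vilenkin_fun_vcylinder.
Qed.

Lemma harmonic_sum_gt0 n : (1 < n)%N -> 0 < harmonic_sum R n.
Proof.
case: n => [//|[//|n]] _; rewrite /harmonic_sum big_nat_recl// invr1.
by rewrite ltr_wpDr// sumr_ge0.
Qed.

(** Each k >= 1 contributes f(x) / k outside the integral; these add up to l_n f(x), and the
    normalisation turns this into f(x). *)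
Lemma riesz_meanE n x f : cintegrable mu f -> (1 < n)%N ->
  riesz_mean mu n f x - f x = ((harmonic_sum R n)^-1)%:C%C *
    complex_integral mu (fun t => (f t - f x) * riesz_kernel n (x - t)).
Proof.
move=> fint n1; rewrite /riesz_mean.
have gint := cintegrableBcst (f x) fint.
have dint k : cintegrable mu (fun t => (f t - f x) * dirichlet R k (x - t)).
  rewrite /dirichlet; under eq_fun do rewrite mulr_sumr.
  by apply: cintegrable_sum => j; exact: (cintegrableM_vilenkin j x gint).
have e : \sum_(1 <= k < n) fourier_sum mu k f x / k%:R =
    complex_integral mu (fun t => (f t - f x) * riesz_kernel n (x - t)) +
    (harmonic_sum R n)%:C%C * f x.
  rewrite rmorph_sum /= mulr_suml.
  have -> : (fun t => (f t - f x) * riesz_kernel n (x - t)) = (fun t =>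
      \sum_(1 <= k < n) (f t - f x) * (dirichlet R k (x - t) / k%:R)).
    by apply/funext => t; rewrite mulr_sumr.
  have kE k : (fun t => (f t - f x) * (dirichlet R k (x - t) / k%:R)) =
      (fun t => k%:R^-1 * ((f t - f x) * dirichlet R k (x - t))).
    by apply/funext => t; rewrite mulrA mulrC.
  rewrite complex_integral_sum; last by move=> k; rewrite kE; exact: cintegrableZ.
  rewrite -big_split /= big_nat_cond [RHS]big_nat_cond.
  apply: eq_bigr => k; rewrite andbT => /andP[k0 _].
  rewrite fourier_sumE// mulrDl; congr (_ + _).
    by rewrite kE complex_integralZ// mulrC.
  by rewrite mulrC; congr (_ * _); rewrite fmorphV rmorph_nat.
rewrite e mulrDr mulrA -rmorphM mulVf ?rmorph1 ?mul1r ?addrK//.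
by rewrite gt_eqF// harmonic_sum_gt0.
Qed.

End KernelRepresentation.

(** * Integration against combinations of indicators *)

Section IntegralsAgainstIndicators.
Context d (T : measurableType d) (R : realType).
Variable mu : {measure set T -> \bar R}.
Implicit Types (C D : set T) (h : T -> R).

Lemma integral_indicM C h : measurable C ->
  (\int[mu]_t (\1_C t * h t)%:E = \int[mu]_(t in C) (h t)%:E)%E.
Proof.
move=> mC; rewrite [RHS]integral_mkcond; apply: eq_integral => t _.
by rewrite patchE indicE; case: ifP => _; rewrite ?mul1r ?mul0r.
Qed.

(** Stated for arbitrary sets and coefficients so that it covers [vker] in either variable as well
    as its truncation in [vker_trunc]. *)
Lemma integral_indic_combination (n : nat) (a : nat -> nat) (k : nat -> nat)
    (C : nat -> nat -> set T) (b : nat) D h :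
  (forall s r, measurable (C s r)) -> measurable D ->
  measurable_fun setT h -> (forall t, 0 <= h t) ->
  (\int[mu]_t ((\sum_(s < n) (a s)%:R * \sum_(r < k s) \1_(C s r) t
                + b%:R * \1_D t) * h t)%:E =
   \sum_(s < n) (a s)%:R%:E * \sum_(r < k s) \int[mu]_(t in C s r) (h t)%:E
                + b%:R%:E * \int[mu]_(t in D) (h t)%:E)%E.
Proof.
move=> mC mD mh h0.
have mi E : measurable E -> measurable_fun setT (fun t => (\1_E t * h t)%:E).
  by move=> mE; apply/measurable_EFinP/measurable_funM => //; exact: measurable_indic.
have i0 E t : (0 <= (\1_E t * h t)%:E)%E by rewrite lee_fin mulr_ge0.
under eq_integral => t _.
  rewrite mulrDl mulr_suml EFinD -sumEFin -mulrA EFinM.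
  under eq_bigr => s _.
    rewrite -mulrA mulr_suml EFinM -sumEFin.
    over.
  over.
rewrite ge0_integralD//; last 4 first.
- move=> t _; apply: sume_ge0 => s _; apply: mule_ge0; first by rewrite lee_fin.
  by apply: sume_ge0.
- apply: emeasurable_sum => s; apply: measurable_funeM.
  by apply: emeasurable_sum => r; exact: mi.
- by move=> t _; apply: mule_ge0; rewrite lee_fin// mulr_ge0.
- by apply: measurable_funeM; exact: mi.
congr (_ + _)%E; last by rewrite ge0_integralZl ?integral_indicM//; exact: mi.
rewrite ge0_integral_sum//; last 2 first.
- move=> s; apply: measurable_funeM.
  by apply: emeasurable_sum => r; exact: mi.
- by move=> s t _; apply: mule_ge0; [rewrite lee_fin|apply: sume_ge0].
apply: eq_bigr => s _; rewrite ge0_integralZl//; last 2 first.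
- by apply: emeasurable_sum => r; exact: mi.
- by move=> t _; apply: sume_ge0.
congr (_ * _)%E; rewrite ge0_integral_sum//; last by move=> r; exact: mi.
by apply: eq_bigr => r _; rewrite integral_indicM.
Qed.

End IntegralsAgainstIndicators.

(** * The nonnegative majorant kernel and the bound for the Riesz means *)

Section Majorant.
Variables (R : realType) (m : nat -> nat).
Hypothesis m2 : forall k, (2 <= m k)%N.
Local Notation G := (vilenkin m).
Local Notation M := (vM m).
Local Notation normc := (@ComplexField.Normc.normc R).
Implicit Types (x y t u : G) (A k s l n : nat).

(* Integrating a function against [vker l x] gives the sum of [vilenkin_W l]
   at x, but with the summation over r started at 0, and of the term at I_l(x). *)
Definition vker l x t : R :=
  \sum_(s < l) (M s)%:R * \sum_(r < m s) \1_(vcylinder l (x - vunit m s *+ r)) t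
  + (M l)%:R * \1_(vcylinder l x) t.

Lemma vker_ge0 l x t : 0 <= vker l x t.
Proof.
rewrite addr_ge0 ?mulr_ge0// sumr_ge0// => s _.
by rewrite mulr_ge0// sumr_ge0.
Qed.

(** If x - t vanishes below l except possibly at s, then t lies in I_l(x - r e_s) for r = (x - t)_s,
    so one indicator in the inner sum equals 1. *)
Lemma vmaj_le_vker l x t : (vmaj l (x - t))%:R <= vker l x t.
Proof.
rewrite /vmaj natrD /vker lerD//.
  rewrite natr_sum ler_sum// => s _; rewrite natrM ler_wpM2l//.
  case: (boolP [forall k : 'I_l, (k == s :> nat) || ((x - t) k == 0)]) => [/forallP h|]; last first.
    rewrite negb_forall => /existsP[k /negPf ks].
    by rewrite /voff (bigD1 k)//= ks mul0n sumr_ge0.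
  rewrite (_ : voff l s (x - t)%R = 1%N); last first.
    by rewrite /voff big1// => k _; rewrite h.
  pose r : nat := (x - t)%R s.
  have rm : (r < m s)%N.
    by have := ltn_ord ((x - t) s); rewrite [X in (_ < X)%N]Zp_cast.
  rewrite (bigD1 (Ordinal rm))//= indicE mem_set ?lerDl ?sumr_ge0//.
  move=> k kl /=; rewrite -[RHS]/(x k - (vunit m s *+ r) k) vunitMn.
  have := h (Ordinal kl); rewrite /=; case: eqP => [-> _|_ /= /eqP xt].
    by rewrite natr_Zp -[(x - t) s]/(x s - t s) subKr.
  by rewrite subr0; apply/esym/eqP; rewrite -subr_eq0; apply/eqP.
rewrite natrM ler_wpM2l// indicE.
case: (boolP [forall k : 'I_l, (x - t) k == 0]) => [/forallP h|]; last first.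
  rewrite negb_forall => /existsP[k /negPf ks].
  by rewrite /vcyl (bigD1 k)//= ks mul0n.
rewrite mem_set ?ler1n.
  by rewrite /vcyl big1// => k _; rewrite h.
move=> k kl /=; apply/esym/eqP; rewrite -subr_eq0.
exact: (h (Ordinal kl)).
Qed.

Lemma normc_riesz_kernel (B : nat) A n x t :
  (forall k, (m k <= B)%N) -> (2 <= n)%N -> (n < M A)%N ->
  normc (riesz_kernel R n (x - t)) <= (4 * B ^ 3)%:R * \sum_(l < A) vker l x t.
Proof.
move=> mB n2 nA; have := norm_sum_dirichlet R m2 mB (x - t) n2 nA.
rewrite complex_normE -(rmorph_nat (real_complex R)) lecR.
move=> /le_trans; apply; rewrite natrM ler_wpM2l// natr_sum.
by apply: ler_sum => l _; exact: vmaj_le_vker.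
Qed.

Lemma indic_vcylinder_sub l x u t :
  \1_(vcylinder l (x - u)) t = \1_(vcylinder l (t + u)) x :> R.
Proof.
rewrite !indicE; congr ((nat_of_bool _)%:R); apply/idP/idP; rewrite !inE => h k kl.
  have tk : t k = x k - u k := h k kl.
  by rewrite -[RHS]/(t k + u k) tk subrK.
have xk : x k = t k + u k := h k kl.
by rewrite -[RHS]/(x k - u k) xk addrK.
Qed.

(** With t fixed, the kernel has the same shape in x, with centres t + r e_s. This gives the second
    marginal. *)
Lemma vkerE l x t : vker l x t =
  \sum_(s < l) (M s)%:R * \sum_(r < m s) \1_(vcylinder l (t + vunit m s *+ r)) x
  + (M l)%:R * \1_(vcylinder l t) x.
Proof.
rewrite /vker; congr (_ + _ * _).
  by apply: eq_bigr => s _; congr (_ * _); apply: eq_bigr => r _; exact: indic_vcylinder_sub.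
by have := indic_vcylinder_sub l x 0 t; rewrite subr0 addr0.
Qed.

(** The value depends only on the first l coordinates of x and of t. Joint measurability is what
    Tonelli's theorem requires. *)
Lemma measurable_vker l : measurable_fun setT (fun z : G * G => vker l z.1 z.2).
Proof.
apply: (@measurable_fun_vcyl2 _ _ _ l) => x y x' y' xx' yy' /=.
have e u : \1_(vcylinder l (x' - u)) y' = \1_(vcylinder l (x - u)) y :> R.
  rewrite !indicE; congr ((nat_of_bool _)%:R); apply/idP/idP; rewrite !inE => h k kl.
    by rewrite -yy'// h// -[LHS]/(x' k - u k) xx'.
  by rewrite yy'// h// -[LHS]/(x k - u k) -xx'.
rewrite /vker; congr (_ + _ * _).
  by apply: eq_bigr => s _; congr (_ * _); apply: eq_bigr => r _; exact: e.
by have := e 0; rewrite !subr0.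
Qed.

Lemma measurable_vkerl l x : measurable_fun setT (vker l x).
Proof. exact: (measurableT_comp (measurable_vker l) (pair1_measurable x)). Qed.

Lemma measurable_vkerr l t : measurable_fun setT (vker l ^~ t).
Proof. exact: (measurableT_comp (measurable_vker l) (pair2_measurable t)). Qed.

Variable mu : probability G R.
Hypothesis hmu : haar mu.

Lemma integral_vker l x (h : G -> R) : measurable_fun setT h -> (forall t, 0 <= h t) ->
  (\int[mu]_t (vker l x t * h t)%:E =
   \sum_(s < l) (M s)%:R%:E * \sum_(r < m s)
     \int[mu]_(t in vcylinder l (x - vunit m s *+ r)%R) (h t)%:E
   + (M l)%:R%:E * \int[mu]_(t in vcylinder l x) (h t)%:E)%E.
Proof.
move=> mh h0.
exact: (integral_indic_combination mu l (vM m) m (M l)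
  (fun s r => measurable_vcylinder l (x - vunit m s *+ r))
  (measurable_vcylinder l x) mh h0).
Qed.

(** The terms are M_1, ..., M_l, and each is at most half of the next. *)
Lemma sum_vM l : (\sum_(s < l) M s * m s <= 2 * M l)%N.
Proof.
elim: l => [|l IH]; first by rewrite big_ord0.
rewrite big_ord_recr /= -vMS mul2n -addnn leq_add2r (leq_trans IH)//.
by rewrite vMS mulnC leq_mul2l m2 orbT.
Qed.

Lemma integral_cst1_vcylinder l y :
  (\int[mu]_(t in vcylinder l y) (cst 1 t)%:E = ((M l)%:R^-1)%:E)%E.
Proof.
transitivity (mu (vcylinder l y)); last exact: mu_vcylinder.
by rewrite -[RHS]mul1e -integral_cst//; exact: measurable_vcylinder.
Qed.

(** The centres are arbitrary, so one computation serves both marginals. Of the bound 3, the double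
    sum gives 2 by [sum_vM], and the last indicator gives 1. *)
Let massE (C : nat -> nat -> G) (z : G) l :
  (\int[mu]_t (\sum_(s < l) (M s)%:R * \sum_(r < m s) \1_(vcylinder l (C s r)) t
                + (M l)%:R * \1_(vcylinder l z) t)%:E <= 3%:E)%E.
Proof.
have := integral_indic_combination mu l (vM m) m (M l)
  (fun s r => measurable_vcylinder l (C s r)) (measurable_vcylinder l z)
  (measurable_cst (1 : R)) (fun=> ler01).
under eq_integral do rewrite mulr1.
move=> ->.
rewrite integral_cst1_vcylinder -EFinM divff ?pnatr_eq0 -?lt0n ?vM_gt0//.
under eq_bigr => s _.
  under eq_bigr do rewrite integral_cst1_vcylinder.
  rewrite sumEFin -EFinM sumr_const card_ord.
  over.
rewrite sumEFin -EFinD lee_fin.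
rewrite (_ : 3 = 2 + 1 :> R); last by rewrite natr1.
rewrite lerD2r; under eq_bigr => s _ do rewrite -[X in _ * X]mulr_natl mulrA -natrM.
rewrite -mulr_suml ler_pdivrMr ?ltr0n ?vM_gt0// -natr_sum -natrM ler_nat.
exact: sum_vM.
Qed.

Lemma vker_massl l x : (\int[mu]_t (vker l x t)%:E <= 3%:E)%E.
Proof. exact: (massE (fun s r => x - vunit m s *+ r) x l). Qed.

Lemma vker_massr l t : (\int[mu]_x (vker l x t)%:E <= 3%:E)%E.
Proof.
under eq_integral do rewrite vkerE.
exact: (massE (fun s r => t + vunit m s *+ r) t l).
Qed.

(** The block of indices from M_A to M_(A+1) - 1 contributes at least (M_(A+1) - M_A) / M_(A+1) >=
    1/2. *)
Lemma harmonic_sum_ge A n : (M A <= n)%N -> A%:R / 2 <= harmonic_sum R n.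
Proof.
move=> An; have mono a b : (a <= b)%N -> harmonic_sum R a <= harmonic_sum R b.
  case: a => [_|a ab]; first by rewrite /harmonic_sum big_geq// sumr_ge0.
  by rewrite /harmonic_sum [leRHS](big_cat_nat (ltn0Sn a) ab)/= lerDl sumr_ge0.
apply: le_trans (mono _ _ An); elim: A {An} => [|A IH].
  by rewrite mul0r /harmonic_sum sumr_ge0.
rewrite /harmonic_sum (big_cat_nat (vM_gt0 m2 A) (leq_vM m2 (leqnSn A)))/=.
rewrite -natr1 mulrDl lerD//.
apply: (@le_trans _ _ (\sum_(M A <= i < M A.+1) (M A.+1)%:R^-1)); last first.
  apply: ler_sum_nat => i /andP[Ai iA]; have i0 := leq_trans (vM_gt0 m2 A) Ai.
  by rewrite lef_pV2 ?posrE ?ltr0n ?vM_gt0// ler_nat ltnW.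
rewrite sumr_const_nat -[leRHS]mulr_natl ler_pdivlMr ?ltr0n ?vM_gt0//.
rewrite mul1r mulrC ler_pdivrMr// -natrM ler_nat vMS.
by have := m2 A; nia.
Qed.

(** Combines l_n >= A / 2 with l_n >= 1, so as to compare l_n with the number A + 1 of levels in
    [vavg], also when A = 0. *)
Lemma harmonic_sum_geS A n : (2 <= n)%N -> (M A <= n)%N ->
  A.+1%:R / 3 <= harmonic_sum R n.
Proof.
move=> n2 /harmonic_sum_ge hA.
have h1 : 1 <= harmonic_sum R n.
  case: n n2 {hA} => [//|[//|n]] _; rewrite /harmonic_sum big_nat_recl// invr1.
  by rewrite lerDl sumr_ge0.
by rewrite -natr1; lra.
Qed.

Definition vavg A x t : R := A.+1%:R^-1 * \sum_(l < A.+1) vker l x t.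

Lemma vavg_ge0 A x t : 0 <= vavg A x t.
Proof. by rewrite mulr_ge0 ?invr_ge0// sumr_ge0// => l _; exact: vker_ge0. Qed.

Lemma measurable_vavg A : measurable_fun setT (fun z : G * G => vavg A z.1 z.2).
Proof.
apply: measurable_funM => //; apply: measurable_sum => l; exact: measurable_vker.
Qed.

Lemma measurable_vavgl A x : measurable_fun setT (vavg A x).
Proof. exact: (measurableT_comp (measurable_vavg A) (pair1_measurable x)). Qed.

Lemma integral_vavg A x (h : G -> R) : measurable_fun setT h -> (forall t, 0 <= h t) ->
  (\int[mu]_t (vavg A x t * h t)%:E =
   (A.+1%:R^-1)%:E * \sum_(l < A.+1) \int[mu]_t (vker l x t * h t)%:E)%E.
Proof.
move=> mh h0.
have mk l : measurable_fun setT (fun t => (vker l x t * h t)%:E).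
  by apply/measurable_EFinP/measurable_funM => //; exact: measurable_vkerl.
have k0 l t : (0 <= (vker l x t * h t)%:E)%E by rewrite lee_fin mulr_ge0 ?vker_ge0.
under eq_integral do rewrite -mulrA mulr_suml EFinM -sumEFin.
rewrite ge0_integralZl//; last 2 first.
- by apply: emeasurable_sum => l; exact: mk.
- by move=> t _; exact: sume_ge0.
by rewrite ge0_integral_sum.
Qed.

Lemma vavg_massl A x : (\int[mu]_t (vavg A x t)%:E <= 3%:E)%E.
Proof.
have := @integral_vavg A x (fun=> 1) (measurable_cst (1 : R)) (fun=> ler01).
under eq_integral do rewrite mulr1.
move=> ->.
apply: (@le_trans _ _ ((A.+1%:R^-1)%:E * \sum_(l < A.+1) 3%:E)%E).
  rewrite lee_wpmul2l ?lee_fin ?invr_ge0//; apply: lee_sum => l _.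
  by under eq_integral do rewrite mulr1; exact: vker_massl.
rewrite sumEFin -EFinM lee_fin sumr_const card_ord -(mulr_natl (3 : R) A.+1).
by rewrite mulKf// pnatr_eq0.
Qed.

(** The constant 24 is 4 from the kernel bound, 2 from [normc_complex_integral] and 3 from
    [harmonic_sum_geS]. The factor A + 1 that turns the sum over levels into the mean [vavg] is
    absorbed by l_n. *)
Lemma normc_riesz_mean_sub (B : nat) A n x (f : G -> R[i]) :
  (forall k, (m k <= B)%N) -> cintegrable mu f ->
  (2 <= n)%N -> (M A <= n < M A.+1)%N ->
  ((normc (riesz_mean mu n f x - f x))%:E <=
   (24 * B ^ 3)%:R%:E * \int[mu]_t (vavg A x t * normc (f t - f x))%:E)%E.
Proof.
move=> mB fint n2 /andP[An nA].
have lgt0 : 0 < harmonic_sum R n by rewrite harmonic_sum_gt0.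
have gint := cintegrableBcst (f x) fint.
have ng0 t : 0 <= normc (f t - f x) by exact: normc_ge0.
have mg : measurable_fun setT (fun t => normc (f t - f x)).
  exact: measurable_normc (cintegrable_measurable gint).
have mQ := cmeasurable_riesz_kernel R n x.
pose K : R := (4 * B ^ 3)%:R * A.+1%:R.
have K0 : 0 <= K by rewrite mulr_ge0.
have Qb t : normc (riesz_kernel R n (x - t)) <= K * vavg A x t.
  rewrite /K /vavg -mulrA mulVKf ?pnatr_eq0//.
  exact: normc_riesz_kernel.
have mav : measurable_fun setT (fun t => (vavg A x t * normc (f t - f x))%:E).
  by apply/measurable_EFinP/measurable_funM => //; exact: measurable_vavgl.
have gQint : cintegrable mu (fun t => (f t - f x) * riesz_kernel R n (x - t)).
  rewrite /riesz_kernel.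
  have -> : (fun t => (f t - f x) * riesz_kernel R n (x - t)) = (fun t =>
      \sum_(1 <= k < n) \sum_(j < k) k%:R^-1 *
        ((f t - f x) * vilenkin_fun R j (x - t))).
    apply/funext => t; rewrite mulr_sumr; apply: eq_bigr => k _.
    by rewrite -mulr_sumr -mulr_sumr mulrA mulrC.
  apply: cintegrable_sum => k; apply: cintegrable_sum => j.
  exact/cintegrableZ/(cintegrableM_vilenkin j x gint).
rewrite riesz_meanE// ComplexField.Normc.normcM.
have -> : normc ((harmonic_sum R n)^-1)%:C%C = (harmonic_sum R n)^-1.
  by rewrite /= expr0n /= addr0 sqrtr_sqr ger0_norm// invr_ge0 ltW.
rewrite EFinM.
apply: (@le_trans _ _ (((harmonic_sum R n)^-1)%:E * (2%:E *
    \int[mu]_t (normc ((f t - f x) * riesz_kernel R n (x - t)))%:E))%E).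
  apply: lee_wpmul2l; first by rewrite lee_fin invr_ge0 ltW.
  exact: normc_complex_integral.
apply: (@le_trans _ _ (((harmonic_sum R n)^-1)%:E * (2%:E *
    (K%:E * \int[mu]_t (vavg A x t * normc (f t - f x))%:E)))%E).
  apply: lee_wpmul2l; first by rewrite lee_fin invr_ge0 ltW.
  apply: lee_wpmul2l; first by rewrite lee_fin.
  rewrite -ge0_integralZl//; last by move=> t _; rewrite lee_fin mulr_ge0 ?vavg_ge0.
  apply: ge0_le_integral => //.
  - by move=> t _; rewrite lee_fin normc_ge0.
  - apply/measurable_EFinP/measurable_normc.
    by apply: cmeasurableM => //; exact: cintegrable_measurable gint.
  - exact: measurable_funeM.
  - move=> t _; rewrite -EFinM lee_fin ComplexField.Normc.normcM mulrC mulrA.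
    by rewrite ler_wpM2r.
rewrite muleA -EFinM muleA -EFinM lee_wpmul2r//.
  by apply: integral_ge0 => t _; rewrite lee_fin mulr_ge0 ?vavg_ge0.
rewrite lee_fin /K -mulrA ler_pdivrMl//.
have := harmonic_sum_geS n2 An.
rewrite ler_pdivrMr// => h.
rewrite !natrM.
have b0 : 0 <= (B ^ 3)%:R :> R by [].
move: h b0; set b := (B ^ 3)%:R; set L := harmonic_sum R n => h b0.
have := ler_wpM2l b0 h; nra.
Qed.

End Majorant.

(** * Growth of the sequence M_n *)

Section Growth.
Variable m : nat -> nat.
Hypothesis m2 : forall k, (2 <= m k)%N.
Local Notation M := (vM m).

Lemma vM_bracket n : (0 < n)%N -> exists A, (M A <= n < M A.+1)%N.
Proof.
move=> n0; have h : exists A, (n < M A)%N by exists n; exact: ltn_vM.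
have := ex_minnP h => -[[|A] nA minA]; first by move: nA; rewrite vM0 ltnNge n0.
exists A; rewrite nA andbT leqNgt; apply/negP => /minA.
by rewrite ltnn.
Qed.

Lemma vM_bracket_ge N A n : (M N <= n)%N -> (n < M A.+1)%N -> (N <= A)%N.
Proof.
move=> Nn nA; rewrite leqNgt; apply/negP => AN.
by have := leq_trans nA (leq_trans (leq_vM m2 AN) Nn); rewrite ltnn.
Qed.

(* The increments [e / M A] sum up geometrically. *)
Lemma telescope_vM (R : realType) (U : nat -> R) (e : R) (A0 : nat) :
  0 <= e -> U @ \oo --> 0 ->
  (forall A, (A0 <= A)%N -> U A <= U A.+1 + e / (M A)%:R) ->
  forall A, (A0 <= A)%N -> U A <= 2 * e / (M A)%:R.
Proof.
move=> e0 U0 hU A AA0.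
have step j : U A <= U (A + j)%N + (2 * e / (M A)%:R - 2 * e / (M (A + j))%:R).
  elim: j => [|j IH]; first by rewrite addn0 subrr addr0.
  apply: (le_trans IH); rewrite addnS.
  have := hU (A + j)%N (leq_trans AA0 (leq_addr _ _)).
  set k := (A + j)%N => hk.
  have Mk : 0 < (M k)%:R :> R by rewrite ltr0n vM_gt0.
  have MSk : 0 < (M k.+1)%:R :> R by rewrite ltr0n vM_gt0.
  have h2 : 2 / (M k.+1)%:R <= 1 / (M k)%:R :> R.
    rewrite ler_pdivrMr// mulrAC ler_pdivlMr// mul1r -natrM ler_nat vMS mulnC.
    by rewrite leq_mul2l m2 orbT.
  have := ler_wpM2l e0 h2; rewrite mulrA [X in _ <= X]mulrA mulr1 (mulrC e 2).
  rewrite -[2 * e / (M k)%:R]mulrA; lra.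
apply/ler_addgt0Pr => d d0.
have /cvgrPdist_le/(_ _ d0)[N _ hN] := U0.
have /= := hN (A + N)%N (leq_addl _ _).
rewrite sub0r normrN => /ler_normlW hd.
apply: (le_trans (step N)); rewrite addrC lerD//.
by rewrite lerBlDr lerDl divr_ge0// mulr_ge0.
Qed.

End Growth.

(** * Convergence at Vilenkin-Lebesgue points *)

Section PointwiseConvergence.
Variables (R : realType) (m : nat -> nat).
Hypothesis m2 : forall k, (2 <= m k)%N.
Local Notation G := (vilenkin m).
Local Notation M := (vM m).
Local Notation normc := (@ComplexField.Normc.normc R).
Variable mu : probability G R.
Hypothesis hmu : haar mu.
Implicit Types (x y t u : G) (A k s l n : nat).
Variables (f : G -> R[i]) (x : G).
Hypothesis fint : cintegrable mu f.
Hypothesis fx : vilenkin_lebesgue_point mu f x.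

Let h t : R := normc (f t - f x).

Let h0 t : 0 <= h t. Proof. exact: normc_ge0. Qed.

Let hint : mu.-integrable setT (EFin \o h).
Proof. exact: (cintegrable_normc (cintegrableBcst (f x) fint)). Qed.

Let mh : measurable_fun setT h.
Proof. by apply/measurable_EFinP; apply: measurable_int hint. Qed.

Let u A : \bar R := (\int[mu]_(t in vcylinder A x) (h t)%:E)%E.

Let cyl_fin A y : (\int[mu]_(t in vcylinder A y) (h t)%:E)%E \is a fin_num.
Proof.
apply: integrable_fin_num => //; first exact: measurable_vcylinder.
by apply: integrableS hint => //; exact: measurable_vcylinder.
Qed.

Let u_fin A : u A \is a fin_num. Proof. exact: cyl_fin. Qed.

Let cyl0 A y : (0 <= \int[mu]_(t in vcylinder A y) (h t)%:E)%E.
Proof. by apply: integral_ge0 => t _; rewrite lee_fin h0. Qed.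

(** Dominated convergence: the cylinders shrink to the point x, where h vanishes, so the integrands
    tend to 0 everywhere. *)
Let u_cvg : (fine (u A)) @[A --> \oo] --> 0.
Proof.
pose F A t : \bar R := (\1_(vcylinder A x) t * h t)%:E.
have mF A : measurable_fun setT (F A).
  by apply/measurable_EFinP/measurable_funM => //;
    apply: measurable_indic; exact: measurable_vcylinder.
have [|||_ _] := @dominated_convergence _ _ _ mu setT measurableT F (fun=> 0%E)
    (EFin \o h) mF _ _ hint _.
- exact: measurable_cst.
- apply: aeW => t _; apply: cvg_near_cst.
  have [->|tx] := EM (t = x).
    near=> A; rewrite /F (_ : h x = 0) ?mulr0//.
    by rewrite /h subrr ComplexField.Normc.normc0.
  have [k kt] : exists k, t k <> x k.
    by apply/existsNP => tk; apply: tx; apply: functional_extensionality_dep.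
  near=> A; rewrite /F indicE memNset ?mul0r// => /(_ k) tk.
  by apply: kt; apply: tk; near: A; exact: nbhs_infty_gt.
- apply: aeW => t A _; rewrite /F /= lee_fin ger0_norm ?mulr_ge0//.
  by rewrite ler_piMl// indicE; case: (_ \in _).
rewrite integral0 => /fine_cvgP[_]; apply: cvg_trans.
by apply: near_eq_cvg; near=> A; rewrite /= integral_indicM//; exact: measurable_vcylinder.
Unshelve. all: by end_near. Qed.

Let w l : \bar R := (\int[mu]_t (vker R l x t * h t)%:E)%E.

(** The r = 0 terms of [vker] all sit on I_l(x); together with its last term they form the
    coefficient of [u l]. *)
Let wE l : (w l = vilenkin_W mu l f x + ((\sum_(s < l) M s + M l)%N)%:R%:E * u l)%E.
Proof.
rewrite /w integral_vker// natrD EFinD ge0_muleDl ?lee_fin//.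
rewrite addeA; congr (_ + _)%E.
rewrite /vilenkin_W natr_sum -sumEFin ge0_sume_distrl; last by move=> s _; rewrite lee_fin.
rewrite -big_split /=; apply: eq_bigr => s _.
rewrite -ge0_muleDr; last 2 first.
- by apply: sume_ge0 => r _; exact: cyl0.
- exact: cyl0.
congr (_ * _)%E.
rewrite -(big_mkord xpredT (fun r => \int[mu]_(t in vcylinder l (x - vunit m s *+ r)%R) (h t)%:E)%E).
by rewrite big_ltn ?(leq_trans _ (m2 s))// mulr0n subr0 addeC.
Qed.

Let sum_vM_le l : (\sum_(s < l) M s <= M l)%N.
Proof.
elim: l => [|l IH]; first by rewrite big_ord0.
rewrite big_ord_recr /= vMS (leq_trans (leq_add IH (leqnn _)))//.
by rewrite addnn -muln2 leq_mul2l m2 orbT.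
Qed.

(** I_A(x) is covered by the cylinders I_(A+1)(x - r e_A). The one with r = 0 gives [u A.+1]; the
    others, times M_A, are the term s = A of W_(A+1). *)
Let u_step A : ((M A)%:R%:E * u A <= (M A)%:R%:E * u A.+1 + vilenkin_W mu A.+1 f x)%E.
Proof.
apply: (@le_trans _ _ ((M A)%:R%:E * u A.+1 + (M A)%:R%:E *
    \sum_(1 <= r < m A) \int[mu]_(t in vcylinder A.+1 (x - vunit m A *+ r)%R) (h t)%:E)%E); last first.
  rewrite leeD2l// /vilenkin_W big_ord_recr /= leeDr//.
  apply: sume_ge0 => s _; apply: mule_ge0; first by rewrite lee_fin.
  by apply: sume_ge0 => r _; exact: cyl0.
rewrite -ge0_muleDr; last 2 first.
- exact: cyl0.
- by apply: sume_ge0 => r _; exact: cyl0.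
apply: lee_wpmul2l; first by rewrite lee_fin.
have -> : (u A.+1 + \sum_(1 <= r < m A)
      \int[mu]_(t in vcylinder A.+1 (x - vunit m A *+ r)%R) (h t)%:E =
    \sum_(r < m A) \int[mu]_(t in vcylinder A.+1 (x - vunit m A *+ r)%R) (h t)%:E)%E.
  rewrite -(big_mkord xpredT
    (fun r => \int[mu]_(t in vcylinder A.+1 (x - vunit m A *+ r)%R) (h t)%:E)%E).
  by rewrite [RHS]big_ltn ?(leq_trans _ (m2 A))// mulr0n subr0.
have mi E : measurable E -> measurable_fun setT (fun t => (\1_E t * h t)%:E).
  by move=> mE; apply/measurable_EFinP/measurable_funM => //; exact: measurable_indic.
have mcyl A' y := @measurable_vcylinder m A' y.
rewrite /u -integral_indicM//.
under eq_bigr do rewrite -integral_indicM//.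
rewrite -ge0_integral_sum//; last 2 first.
- by move=> r; exact: mi.
- by move=> r t _; rewrite lee_fin mulr_ge0.
apply: ge0_le_integral => //.
- by move=> t _; rewrite lee_fin mulr_ge0.
- exact: mi.
- by apply: emeasurable_sum => r; exact: mi.
- move=> t _; rewrite sumEFin lee_fin -mulr_suml ler_wpM2r//.
  rewrite indicE; case: (boolP (t \in _)) => [|_]; last by rewrite sumr_ge0.
  rewrite inE => xt; pose r : nat := (x - t)%R A.
  have rm : (r < m A)%N.
    by have := ltn_ord ((x - t) A); rewrite [X in (_ < X)%N]Zp_cast.
  rewrite (bigD1 (Ordinal rm))//= indicE mem_set ?lerDl ?sumr_ge0//.
  move=> k; rewrite ltnS leq_eqVlt -[(x - _) k]/(x k - (vunit m A *+ r) k) vunitMn.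
  move=> /orP[/eqP ->|kA].
    by rewrite eqxx natr_Zp -[(x - t) A]/(x A - t A) subKr.
  by rewrite ltn_eqF// subr0 xt.
Qed.

Let W_small (e : R) : 0 < e -> exists A0, forall A, (A0 <= A)%N ->
  (vilenkin_W mu A f x <= e%:E)%E.
Proof.
move=> e0; have /fine_cvgP[Wfin /cvgrPdist_le/(_ _ e0) We] := fx.
have [N _ hN] := filterI Wfin We.
exists N => A NA; have [/= Af] := hN A NA.
rewrite sub0r normrN => /ler_normlW; rewrite -lee_fin fineK//.
Qed.

Let w_fin l : w l \is a fin_num.
Proof.
rewrite /w integral_vker// fin_numD; apply/andP; split; last by rewrite fin_numM.
apply/sum_fin_numP => s _ _; rewrite fin_numM//.
by apply/sum_fin_numP => r _ _; exact: cyl_fin.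
Qed.

Let w_ge0 l : (0 <= w l)%E.
Proof. by apply: integral_ge0 => t _; rewrite lee_fin mulr_ge0// vker_ge0. Qed.

Let w_cvg : (fine (w l)) @[l --> \oo] --> 0.
Proof.
apply/cvgrPdist_le => e e0.
(* One share of e / 5 is for W_l. The other four bound 2 M_l [u l], since telescoping gives M_l
   [u l] <= 2 e / 5. *)
have e5 : 0 < e / 5 by rewrite divr_gt0.
have [A0 hA0] := W_small e5.
have U2 : forall A, (A0 <= A)%N -> fine (u A) <= 2 * (e / 5) / (M A)%:R.
  apply: telescope_vM => //; first exact: ltW.
  move=> A AA0; have := u_step A.
  have Mp : 0 < (M A)%:R :> R by rewrite ltr0n vM_gt0.
  rewrite -(fineK (u_fin A)) -(fineK (u_fin A.+1)).
  move=> /le_trans /(_ (leeD2l _ (hA0 A.+1 (leqW AA0)))).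
  rewrite -!EFinM -EFinD lee_fin => H.
  by rewrite -(ler_pM2l Mp) mulrDr mulrCA divff ?gt_eqF// mulr1.
near=> l.
have lA0 : (A0 <= l)%N by near: l; exact: nbhs_infty_ge.
have Mp : 0 < (M l)%:R :> R by rewrite ltr0n vM_gt0.
rewrite sub0r normrN ger0_norm ?fine_ge0// -lee_fin fineK// wE.
have H := U2 l lA0; rewrite ler_pdivlMr// in H.
apply: (@le_trans _ _ ((e / 5)%:E + (4 * (e / 5))%:E)%E); last first.
  by rewrite -EFinD lee_fin; lra.
apply: leeD; first exact: hA0.
rewrite -(fineK (u_fin l)) -EFinM lee_fin.
apply: (@le_trans _ _ ((2 * M l)%:R * fine (u l))).
  rewrite ler_wpM2r ?fine_ge0 ?integral_ge0// => [t _|]; first by rewrite lee_fin.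
  by rewrite ler_nat mul2n -addnn leq_add2r.
by rewrite natrM; lra.
Unshelve. all: by end_near. Qed.

Lemma riesz_mean_cvg_lebesgue_point (B : nat) : (forall k, (m k <= B)%N) ->
  (riesz_mean mu n f x : R[i]^o) @[n --> \oo] --> (f x : R[i]^o).
Proof.
move=> mB; pose c := arithmetic_mean (fun l => fine (w l)).
have c0 : c @ \oo --> 0 by exact: cesaro.
pose K : R := (24 * B ^ 3)%:R.
have bound A n : (2 <= n)%N -> (M A <= n < M A.+1)%N ->
    normc (riesz_mean mu n f x - f x) <= K * c A.
  move=> n2 nA; rewrite -lee_fin.
  apply: (le_trans (normc_riesz_mean_sub m2 hmu x mB fint n2 nA)).
  rewrite integral_vavg// EFinM; apply: lee_wpmul2l; first by rewrite lee_fin.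
  rewrite /c /arithmetic_mean /series /= EFinM big_mkord -sumEFin.
  by rewrite le_eqVlt; apply/orP; left; apply/eqP; congr (_ * _)%E;
    apply: eq_bigr => l _; rewrite fineK.
(* The radius is a positive element of [R[i]], and the order there forces its imaginary part to be
   0. *)
apply/cvgrPdist_le => -[e e'] /=; rewrite ltcE /= => /andP[/eqP -> e0].
have K1 : 0 < K + 1 by rewrite ltr_wpDl.
have eK : 0 < e / (K + 1) by rewrite divr_gt0.
have /cvgrPdist_le/(_ _ eK)[N _ hN] := c0.
near=> n.
have n2 : (2 <= n)%N by near: n; exact: nbhs_infty_ge.
have nM : (M N <= n)%N by near: n; exact: nbhs_infty_ge.
have [A /[dup] nA /andP[_ nA']] := vM_bracket m2 (ltnW n2).
have /= := hN A (vM_bracket_ge m2 nM nA').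
rewrite sub0r normrN => /ler_normlW cA.
rewrite distrC complex_normE lecE /= eqxx /=.
apply: (le_trans (bound A n n2 nA)).
have K0 : 0 <= K by [].
apply: (le_trans (ler_wpM2l K0 cA)).
rewrite mulrA ler_pdivrMr// mulrC ler_wpM2l ?ltW// ltrDl//.
Unshelve. all: by end_near. Qed.

End PointwiseConvergence.

(** * Increments in p-th power, integrated against the majorant kernel *)

Lemma powRD_le (R : realType) (p a b : R) : 1 <= p -> 0 <= a -> 0 <= b ->
  (a + b) `^ p <= 2 `^ p * (a `^ p + b `^ p).
Proof.
move=> p1 a0 b0; have p0 : 0 <= p by apply: le_trans p1.
wlog ab : a b a0 b0 / a <= b.
  by move=> H; have [/H|/ltW/H] := leP a b; [exact|rewrite addrC [X in _ * X]addrC; exact].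
apply: (@le_trans _ _ ((2 * b) `^ p)).
  by rewrite ge0_ler_powR// ?nnegrE ?addr_ge0 ?mulr_ge0// mulr_natl mulr2n lerD2r.
by rewrite powRM// ler_wpM2l ?powR_ge0// lerDr powR_ge0.
Qed.

Lemma measurable_norm_powR d (T : measurableType d) (R : realType) (p : R) (h : T -> R) :
  measurable_fun setT h -> measurable_fun setT (fun t => `|h t| `^ p).
Proof.
move=> mh; have mn := measurableT_comp (@normr_measurable R setT) mh.
exact: (measurableT_comp (measurable_powR p) mn).
Qed.

Section IntegralModulus.
Variables (R : realType) (m : nat -> nat).
Hypothesis m2 : forall k, (2 <= m k)%N.
Local Notation G := (vilenkin m).
Local Notation M := (vM m).
Variable mu : probability G R.
Hypothesis hmu : haar mu.
Implicit Types (x y t u : G) (A k s l n : nat) (F : G * G -> R) (g : G -> R).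

Definition vker_int l F : \bar R :=
  (\int[(mu \x mu)]_z (vker R l z.1 z.2 * F z)%:E)%E.

Let mvF l F : measurable_fun setT F ->
  measurable_fun setT (fun z : G * G => (vker R l z.1 z.2 * F z)%:E).
Proof.
move=> mF; apply/measurable_EFinP/measurable_funM => //; exact: measurable_vker.
Qed.

Lemma le_vker_int l F F' : measurable_fun setT F -> measurable_fun setT F' ->
  (forall z, 0 <= F z) -> (forall z, F z <= F' z) ->
  (vker_int l F <= vker_int l F')%E.
Proof.
move=> mF mF' F0 FF'; apply: ge0_le_integral => //.
- by move=> z _; rewrite lee_fin mulr_ge0// vker_ge0.
- exact: mvF.
- exact: mvF.
- by move=> z _; rewrite lee_fin ler_wpM2l// vker_ge0.
Qed.

Lemma vker_intD l F F' : measurable_fun setT F -> measurable_fun setT F' ->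
  (forall z, 0 <= F z) -> (forall z, 0 <= F' z) ->
  (vker_int l (fun z => (F z + F' z)%R) = vker_int l F + vker_int l F')%E.
Proof.
move=> mF mF' F0 F'0; rewrite /vker_int -ge0_integralD//.
- by apply: eq_integral => z _; rewrite mulrDr EFinD.
- by move=> z _; rewrite lee_fin mulr_ge0// vker_ge0.
- exact: mvF.
- by move=> z _; rewrite lee_fin mulr_ge0// vker_ge0.
- exact: mvF.
Qed.

Lemma vker_intZ l F c : measurable_fun setT F -> (forall z, 0 <= F z) -> 0 <= c ->
  (vker_int l (fun z => (c * F z)%R) = c%:E * vker_int l F)%E.
Proof.
move=> mF F0 c0; rewrite /vker_int -ge0_integralZl//.
- by apply: eq_integral => z _; rewrite mulrCA EFinM.
- exact: mvF.
- by move=> z _; rewrite lee_fin mulr_ge0// vker_ge0.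
Qed.

Lemma vker_int_iter l F : measurable_fun setT F -> (forall z, 0 <= F z) ->
  (vker_int l F = \int[mu]_x \int[mu]_t (vker R l x t * F (x, t))%:E)%E.
Proof.
move=> mF F0; rewrite /vker_int fubini_tonelli1//; first exact: mvF.
by move=> z; rewrite lee_fin mulr_ge0// vker_ge0.
Qed.

Lemma vker_int_iter2 l F : measurable_fun setT F -> (forall z, 0 <= F z) ->
  (vker_int l F = \int[mu]_t \int[mu]_x (vker R l x t * F (x, t))%:E)%E.
Proof.
move=> mF F0; rewrite /vker_int fubini_tonelli2//; first exact: mvF.
by move=> z; rewrite lee_fin mulr_ge0// vker_ge0.
Qed.

Lemma vker_int_fst l g : measurable_fun setT g -> (forall t, 0 <= g t) ->
  (vker_int l (fun z => g z.1) <= 3%:E * \int[mu]_t (g t)%:E)%E.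
Proof.
move=> mg g0; have mF : measurable_fun setT (fun z : G * G => g z.1).
  exact: measurableT_comp mg (@measurable_fst _ _ G G).
rewrite vker_int_iter// -ge0_integralZl//; last 2 first.
- exact/measurable_EFinP.
- by move=> t _; rewrite lee_fin.
apply: ge0_le_integral => //.
- move=> x _; apply: integral_ge0 => t _.
  by rewrite lee_fin mulr_ge0// vker_ge0.
- apply: (measurable_fun_fubini_tonelli_F
    (fun z : G * G => (vker R l z.1 z.2 * g z.1)%:E)).
  + exact: (mvF l mF).
  + by move=> z; rewrite lee_fin mulr_ge0// vker_ge0.
- exact/measurable_funeM/measurable_EFinP.
- move=> x _ /=; under eq_integral do rewrite mulrC EFinM.
  rewrite ge0_integralZl//; last 3 first.
  + by apply/measurable_EFinP; exact: measurable_vkerl.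
  + by move=> t _; rewrite lee_fin vker_ge0.
  + by rewrite lee_fin.
  by rewrite [leRHS]muleC; apply: lee_wpmul2l; [rewrite lee_fin|exact: vker_massl].
Qed.

Lemma vker_int_snd l g : measurable_fun setT g -> (forall t, 0 <= g t) ->
  (vker_int l (fun z => g z.2) <= 3%:E * \int[mu]_t (g t)%:E)%E.
Proof.
move=> mg g0; have mF : measurable_fun setT (fun z : G * G => g z.2).
  exact: measurableT_comp mg (@measurable_snd _ _ G G).
rewrite vker_int_iter2// -ge0_integralZl//; last 2 first.
- exact/measurable_EFinP.
- by move=> t _; rewrite lee_fin.
apply: ge0_le_integral => //.
- move=> x _; apply: integral_ge0 => t _.
  by rewrite lee_fin mulr_ge0// vker_ge0.
- apply: (measurable_fun_fubini_tonelli_G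
    (fun z : G * G => (vker R l z.1 z.2 * g z.2)%:E)).
  + exact: (mvF l mF).
  + by move=> z; rewrite lee_fin mulr_ge0// vker_ge0.
- exact/measurable_funeM/measurable_EFinP.
- move=> x _ /=; under eq_integral do rewrite mulrC EFinM.
  rewrite ge0_integralZl//; last 3 first.
  + by apply/measurable_EFinP; exact: measurable_vkerr.
  + by move=> t _; rewrite lee_fin vker_ge0.
  + by rewrite lee_fin.
  by rewrite [leRHS]muleC; apply: lee_wpmul2l; [rewrite lee_fin|exact: vker_massr].
Qed.

Variable p : R.
Hypothesis p1 : 1 <= p.

Let p0 : 0 <= p. Proof. exact: le_trans p1. Qed.

Let p_gt0 : 0 < p. Proof. exact: lt_le_trans p1. Qed.

Definition pincr g (z : G * G) : R := `|g z.2 - g z.1| `^ p.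

(** A vanishing integral modulus of continuity. It is phrased by inequalities in the extended reals,
    so that no finiteness has to be known in advance. *)
Definition vker_continuous g := measurable_fun setT g /\
  forall e, 0 < e -> exists N, forall l, (N <= l)%N -> (vker_int l (pincr g) <= e%:E)%E.

Lemma measurable_pincr g : measurable_fun setT g -> measurable_fun setT (pincr g).
Proof.
move=> mg; apply: measurable_norm_powR; apply: measurable_funB.
  exact: measurableT_comp mg (@measurable_snd _ _ G G).
exact: measurableT_comp mg (@measurable_fst _ _ G G).
Qed.

Lemma pincr_ge0 g z : 0 <= pincr g z.
Proof. exact: powR_ge0. Qed.

(** Common source of stability under scalars, sums, complements and unions. When only one function
    is involved, the constant 0 serves as [g2]. *)
Lemma vker_continuous_dom (C : R) g g1 g2 : measurable_fun setT g -> 0 <= C ->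
  (forall z, pincr g z <= C * (pincr g1 z + pincr g2 z)) ->
  vker_continuous g1 -> vker_continuous g2 -> vker_continuous g.
Proof.
move=> mg C0 gC [mg1 h1] [mg2 h2]; split=> [|e e0]; first exact: mg.
have C1 : 0 < C + 1 by rewrite ltr_wpDl.
have d0 : 0 < e / (C + 1) / 2 by rewrite !divr_gt0.
have [N1 hN1] := h1 _ d0; have [N2 hN2] := h2 _ d0.
exists (maxn N1 N2) => l; rewrite geq_max => /andP[l1 l2].
have mp1 := measurable_pincr mg1; have mp2 := measurable_pincr mg2.
apply: (@le_trans _ _ (vker_int l (fun z => C * (pincr g1 z + pincr g2 z)))).
  apply: le_vker_int => //; first exact: measurable_pincr.
  - by apply: measurable_funM => //; exact: measurable_funD.
  - by move=> z; exact: pincr_ge0.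
rewrite vker_intZ//; last 2 first.
- exact: measurable_funD.
- by move=> z; rewrite addr_ge0// pincr_ge0.
rewrite vker_intD//; [|by move=> z; exact: pincr_ge0..].
apply: (@le_trans _ _ (C%:E * ((e / (C + 1) / 2)%:E + (e / (C + 1) / 2)%:E))%E).
  apply: lee_wpmul2l; first by rewrite lee_fin.
  by apply: leeD; [exact: hN1|exact: hN2].
rewrite -EFinD -EFinM lee_fin -splitr mulrA ler_pdivrMr// mulrC.
by rewrite ler_wpM2l ?ltW// ltrDl.
Qed.

Lemma vker_continuous_cst c : vker_continuous (fun=> c).
Proof.
split=> [|e e0]; first exact: measurable_cst.
exists 0%N => l _; rewrite /vker_int; apply: (@le_trans _ _ 0%E); last by rewrite lee_fin ltW.
rewrite le_eqVlt; apply/orP; left; apply/eqP.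
apply: integral0_eq => z _.
by rewrite /pincr subrr normr0 powR0 ?mulr0// gt_eqF.
Qed.

Lemma vker_continuousZ c g : vker_continuous g -> vker_continuous (fun t => c * g t).
Proof.
move=> hg; apply: (vker_continuous_dom (C := `|c| `^ p) _ _ _ hg (vker_continuous_cst 0)).
- by apply: measurable_funM => //; exact: hg.1.
- exact: powR_ge0.
- move=> z; rewrite /pincr subrr normr0 powR0 ?gt_eqF// addr0 -mulrBr normrM.
  by rewrite powRM.
Qed.

Lemma vker_continuousD g g' : vker_continuous g -> vker_continuous g' ->
  vker_continuous (fun t => g t + g' t).
Proof.
move=> hg hg'; apply: (vker_continuous_dom (C := 2 `^ p) _ _ _ hg hg').
- by apply: measurable_funD => //; [exact: hg.1|exact: hg'.1].
- exact: powR_ge0.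
- move=> z; apply: le_trans (powRD_le p1 (normr_ge0 _) (normr_ge0 _)).
  rewrite /pincr ge0_ler_powR// ?nnegrE// ?addr_ge0//.
  by rewrite opprD addrACA ler_normD.
Qed.

(** The increment of g is that of [gn n] plus the errors at the two points. The marginal masses
    bound the integrated errors uniformly in l, so n can be fixed first and the level chosen
    afterwards. *)
Lemma vker_continuous_cvg (gn : nat -> G -> R) g (phi : G -> R) :
  (forall n, vker_continuous (gn n)) -> measurable_fun setT g ->
  (forall t, gn n t @[n --> \oo] --> g t) ->
  (forall n t, `|gn n t - g t| `^ p <= phi t) ->
  mu.-integrable setT (EFin \o phi) ->
  vker_continuous g.
Proof.
move=> hgn mg gng gnphi iphi; split=> [|e e0]; first exact: mg.
pose D n t : R := `|g t - gn n t| `^ p.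
have mD n : measurable_fun setT (D n).
  apply: measurable_norm_powR.
  by apply: measurable_funB => //; exact: (hgn n).1.
have D0 : (\int[mu]_t (D n t)%:E)%E @[n --> \oo] --> 0%E.
  have [||||_ _] := @dominated_convergence _ _ _ mu setT measurableT
      (fun n => EFin \o D n) (fun=> 0%E) (EFin \o phi) _ _ _ iphi _.
  - by move=> n; exact/measurable_EFinP.
  - exact: measurable_cst.
  - apply: aeW => t _; apply/fine_cvgP; split; first exact: nearW.
    apply/cvgrPdist_le => d d0.
    (* For 0 <= u <= 1 and p >= 1 one has u^p <= u, so a distance below min(d, 1) has p-th power at
       most d. *)
    have d1 : 0 < Num.min d 1 by rewrite lt_min d0 ltr01.
    have /cvgrPdist_le/(_ _ d1) := gng t; apply: filterS => n /=.
    rewrite le_min => /andP[ud u1].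
    rewrite sub0r normrN /D ger0_norm ?powR_ge0//.
    apply: le_trans ud; have [->|u0] := eqVneq `|g t - gn n t| 0.
      by rewrite powR0// gt_eqF.
    rewrite -[leRHS]powRr1//; apply: ger_powR => //.
    by rewrite u1 andbT lt_neqAle eq_sym u0 /=.
  - apply: aeW => t n _; rewrite /= lee_fin ger0_norm ?powR_ge0//.
    by rewrite /D distrC.
  by rewrite integral0.
pose C : R := 2 `^ p.
have C0 : 0 < C by rewrite powR_gt0.
(* Makes C (d + C (3 d + 3 d)) equal to e; the two 3's are the marginal masses. *)
pose d : R := e / (C * (C * 6 + 1)).
have d0 : 0 < d by rewrite divr_gt0// mulr_gt0// ltr_wpDl// mulr_ge0// ltW.
have [n hn] : exists n, (\int[mu]_t (D n t)%:E <= d%:E)%E.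
  have /fine_cvgP[Df /cvgrPdist_le/(_ _ d0) Dd] := D0.
  have [N _ hN] := filterI Df Dd.
  exists N; have [/= f1 +] := hN N (leqnn N).
  rewrite sub0r normrN => /ler_normlW; by rewrite -lee_fin fineK.
have [_ /(_ _ d0)[N hN]] := hgn n.
exists N => l /hN hl.
have mgn := (hgn n).1.
have mpgn := measurable_pincr mgn.
have mD1 : measurable_fun setT (fun z : G * G => D n z.1).
  exact: measurableT_comp (mD n) (@measurable_fst _ _ G G).
have mD2 : measurable_fun setT (fun z : G * G => D n z.2).
  exact: measurableT_comp (mD n) (@measurable_snd _ _ G G).
have D00 z : 0 <= D n z by exact: powR_ge0.
have mDD : measurable_fun setT (fun z : G * G => C * (D n z.2 + D n z.1)).
  by apply: measurable_funM => //; exact: measurable_funD.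
have DD0 z : 0 <= C * (D n z.2 + D n z.1) :> R.
  by rewrite mulr_ge0 ?addr_ge0// ltW.
apply: (@le_trans _ _ (vker_int l (fun z => C * (pincr (gn n) z + C * (D n z.2 + D n z.1))))).
  apply: le_vker_int.
  - exact: measurable_pincr.
  - by apply: measurable_funM => //; exact: measurable_funD.
  - by move=> z; exact: pincr_ge0.
  - move=> z; apply: (@le_trans _ _ (C * (pincr (gn n) z +
        (`|g z.2 - gn n z.2| + `|g z.1 - gn n z.1|) `^ p))); last first.
      by rewrite ler_pM2l// lerD2l powRD_le.
    apply: le_trans (powRD_le p1 (normr_ge0 _) (addr_ge0 (normr_ge0 _) (normr_ge0 _))).
    rewrite /pincr ge0_ler_powR// ?nnegrE// ?addr_ge0//.
    rewrite (distrC (g z.1)) addrA.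
    rewrite (_ : g z.2 - g z.1 = (gn n z.2 - gn n z.1) + (g z.2 - gn n z.2)
      + (gn n z.1 - g z.1)); last by ring.
    by apply: (le_trans (ler_normD _ _)); rewrite lerD2r ler_normD.
rewrite vker_intZ//; last 3 first.
- exact: measurable_funD.
- by move=> z; rewrite addr_ge0// pincr_ge0.
- exact: ltW.
rewrite vker_intD//; last by move=> z; exact: pincr_ge0.
rewrite vker_intZ//; last 3 first.
- exact: measurable_funD.
- by move=> z; rewrite addr_ge0.
- exact: ltW.
rewrite vker_intD//.
apply: (@le_trans _ _ (C%:E * (d%:E + C%:E * (3%:E * d%:E + 3%:E * d%:E)))%E).
  apply: lee_wpmul2l; first by rewrite lee_fin ltW.
  apply: leeD => //.
  apply: lee_wpmul2l; first by rewrite lee_fin ltW.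
  apply: leeD.
    by apply: (le_trans (vker_int_snd l (mD n) D00)); apply: lee_wpmul2l => //; rewrite lee_fin.
  by apply: (le_trans (vker_int_fst l (mD n) D00)); apply: lee_wpmul2l => //; rewrite lee_fin.
rewrite -[leLHS]/((C * (d + C * (3 * d + 3 * d)))%:E) lee_fin.
rewrite (_ : C * (d + C * (3 * d + 3 * d)) = d * (C * (C * 6 + 1))); last by ring.
by rewrite /d divfK// gt_eqF// mulr_gt0// ltr_wpDl// mulr_ge0// ltW.
Qed.

End IntegralModulus.

(** * From cylinder sets to all of L_p *)

Section DenseClasses.
Variables (R : realType) (m : nat -> nat).
Hypothesis m2 : forall k, (2 <= m k)%N.
Local Notation G := (vilenkin m).
Local Notation M := (vM m).
Variable mu : probability G R.
Hypothesis hmu : haar mu.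
Variable p : R.
Hypothesis p1 : 1 <= p.
Implicit Types (x y t u : G) (A k s l n : nat) (g : G -> R) (B V U : set G).

Let p_gt0 : 0 < p. Proof. exact: lt_le_trans p1. Qed.

Let pow1p : 1 `^ p = 1 :> R. Proof. by rewrite powR1. Qed.

Let indic (B : set G) : G -> R := \1_B.

Let indic_eq B (x t : G) : (B x <-> B t) -> indic B t - indic B x = 0.
Proof.
move=> Bxt; rewrite /indic !indicE; apply/eqP; rewrite subr_eq0; apply/eqP.
by congr ((nat_of_bool _)%:R); apply/idP/idP; rewrite !inE Bxt.
Qed.

Let indic_dist_le1 B (x t : G) : `|indic B t - indic B x| <= 1.
Proof.
rewrite /indic !indicE; case: (_ \in _); case: (_ \in _);
  by rewrite ?subrr ?subr0 ?sub0r ?normrN ?normr1 ?normr0.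
Qed.

Let indic_dist_neq B (x t : G) : ~ (B x <-> B t) -> `|indic B t - indic B x| = 1.
Proof.
rewrite /indic !indicE => Bxt.
have [Bt|Bt] := EM (B t); have [Bx|Bx] := EM (B x).
- by exfalso; apply: Bxt; split.
- by rewrite mem_set// memNset// subr0 normr1.
- by rewrite memNset// mem_set// sub0r normrN normr1.
- by exfalso; apply: Bxt; split.
Qed.

(** For s >= N the centre x - r e_s agrees with x below N, so its cylinder of level l >= N lies in
    I_N(x) and misses t. The zero summand gives the bound the shape of
    [integral_indic_combination]. *)
Lemma vker_trunc N l x t : (N <= l)%N -> ~ vcylinder N x t ->
  vker R l x t <= \sum_(s < N) (M s)%:R * \sum_(r < m s) \1_(vcylinder l (x - vunit m s *+ r)) t
  + 0%:R * \1_(set0 : set G) t.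
Proof.
move=> Nl xt; rewrite mul0r addr0 /vker indicE memNset ?mulr0 ?addr0; last first.
  by move=> h; apply: xt; exact: vcylinder_le Nl _ h.
rewrite -!(big_mkord xpredT (fun s => (M s)%:R *
  \sum_(r < m s) \1_(vcylinder l (x - vunit m s *+ r)) t)).
rewrite (big_cat_nat (leq0n N) Nl)/= -[leRHS]addr0 lerD2l.
rewrite big_nat_cond big1// => s; rewrite andbT => /andP[Ns sl].
rewrite big1 ?mulr0// => r _; rewrite indicE memNset// => h; apply: xt => k kN.
rewrite (h k (leq_trans kN Nl)) -[LHS]/(x k - (vunit m s *+ r) k) vunitMn.
by rewrite ltn_eqF ?subr0// (leq_trans kN).
Qed.

(** The indicator has no increment inside I_N(x), and outside its increments are at most 1. There
    the truncated kernel has mass at most 2 M_N / M_l, which tends to 0 with N fixed. *)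
Lemma vker_continuous_vcyl_inv N V : (forall x y, V x -> vcylinder N x y -> V y) ->
  vker_continuous mu p (indic V).
Proof.
move=> hV; have mV := measurable_vcyl_inv hV.
have mI : measurable_fun setT (indic V) by exact: measurable_indic.
split=> [|e e0]; first exact: mI.
have Vxt x t : vcylinder N x t -> (V x <-> V t).
  by move=> h; split=> [/hV|/hV]; apply=> //; exact: vcylinder_sym.
have bound l x : (N <= l)%N ->
    (\int[mu]_t (vker R l x t * pincr p (indic V) (x, t))%:E <=
     ((2 * M N)%:R / (M l)%:R)%:E)%E.
  move=> Nl.
  have mcyl r s := measurable_vcylinder l (x - vunit m s *+ r).
  pose H t : R := \sum_(s < N) (M s)%:R * \sum_(r < m s) \1_(vcylinder l (x - vunit m s *+ r)) t
    + 0%:R * \1_(set0 : set G) t.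
  have H0 t : 0 <= H t.
    rewrite /H mul0r addr0 sumr_ge0// => s _.
    by rewrite mulr_ge0// sumr_ge0.
  have mH : measurable_fun setT H.
    apply: measurable_funD; last first.
      by apply: measurable_funM => //; exact: measurable_indic.
    apply: measurable_sum => s; apply: measurable_funM => //.
    by apply: measurable_sum => r; exact: measurable_indic.
  apply: (@le_trans _ _ (\int[mu]_t (H t * 1)%:E)%E).
    apply: ge0_le_integral => //.
    - by move=> t _; rewrite lee_fin mulr_ge0 ?vker_ge0// pincr_ge0.
    - apply/measurable_EFinP/measurable_funM; first exact: measurable_vkerl.
      exact: (measurableT_comp (measurable_pincr p mI) (pair1_measurable x)).
    - by apply/measurable_EFinP/measurable_funM.
    - move=> t _; rewrite lee_fin.
      have [xt|xt] := EM (vcylinder N x t).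
        rewrite /pincr /= indic_eq; last exact: Vxt.
        by rewrite normr0 powR0 ?gt_eqF// mulr0 mulr1.
      apply: ler_pM => //; [exact: vker_ge0|exact: pincr_ge0|exact: vker_trunc|].
      by rewrite -pow1p /pincr ge0_ler_powR ?nnegrE ?(ltW p_gt0) ?indic_dist_le1.
  rewrite (integral_indic_combination mu N (vM m) m 0
    (fun s r => mcyl r s) measurable0 (measurable_cst (1 : R)) (fun=> ler01)).
  rewrite integral_set0 mule0 adde0.
  under eq_bigr => s _.
    under eq_bigr do rewrite (integral_cst1_vcylinder m2 hmu).
    rewrite sumEFin -EFinM sumr_const card_ord.
    over.
  rewrite sumEFin lee_fin.
  under eq_bigr => s _ do rewrite -[X in _ * X]mulr_natl mulrA -natrM.
  by rewrite -mulr_suml ler_wpM2r ?invr_ge0// -natr_sum ler_nat sum_vM.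
have mF := measurable_pincr p mI.
(* Since l < M_l, every l >= q satisfies 2 M_N / M_l <= e. *)
pose q : R := (2 * M N)%:R / e.
exists (maxn N (Num.truncn q).+1) => l; rewrite geq_max => /andP[Nl ql].
rewrite vker_int_iter//; last by move=> z; exact: pincr_ge0.
apply: (@le_trans _ _ (\int[mu]_x (cst ((2 * M N)%:R / (M l)%:R)%:E x))%E).
  apply: ge0_le_integral => //.
  - move=> x _; apply: integral_ge0 => t _.
    by rewrite lee_fin mulr_ge0 ?vker_ge0// pincr_ge0.
  - apply: (measurable_fun_fubini_tonelli_F
      (fun z : G * G => (vker R l z.1 z.2 * pincr p (indic V) z)%:E)).
    + by apply/measurable_EFinP/measurable_funM => //; exact: measurable_vker.
    + by move=> z; rewrite lee_fin mulr_ge0 ?vker_ge0// pincr_ge0.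
  - by move=> x _; exact: bound.
rewrite integral_cst//.
apply: (@le_trans _ _ (((2 * M N)%:R / (M l)%:R)%:E * 1%:E)%E).
  apply: lee_wpmul2l; first by rewrite lee_fin divr_ge0.
  by rewrite le_eqVlt; apply/orP; left; apply/eqP; exact: probability_setT.
rewrite mule1 lee_fin ler_pdivrMr ?ltr0n ?vM_gt0// mulrC -ler_pdivrMr//.
rewrite -/q; apply: (@le_trans _ _ l%:R).
  by apply: le_trans (_ : (Num.truncn q).+1%:R <= _); [apply/ltW/truncnS_gt|rewrite ler_nat].
by rewrite ler_nat ltnW// ltn_vM.
Qed.

Let vker_continuous_indic_cvg (Vn : nat -> set G) V :
  (forall n, vker_continuous mu p (indic (Vn n))) -> measurable V ->
  (forall t, \forall n \near \oo, Vn n t <-> V t) ->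
  vker_continuous mu p (indic V).
Proof.
move=> hVn mV VnV.
apply: (@vker_continuous_cvg _ _ m2 _ hmu _ p1 (fun n => indic (Vn n)) _ (fun=> 1)) => //.
- exact: measurable_indic.
- move=> t; apply: cvg_near_cst; apply: filterS (VnV t) => n VVn.
  by rewrite /indic !indicE; congr ((nat_of_bool _)%:R); apply/idP/idP; rewrite !inE VVn.
- move=> n t; rewrite -pow1p ge0_ler_powR ?nnegrE// ?(ltW p_gt0)//.
  rewrite /indic !indicE; case: (_ \in _); case: (_ \in _);
    by rewrite ?subrr ?subr0 ?sub0r ?normrN ?normr1 ?normr0.
- exact: (finite_measure_integrable_cst mu 1).
Qed.

(** An open set is the increasing union of the sets [Un n] of points whose cylinder of level n it
    contains, and [Un n] is invariant at level n. *)
Lemma vker_continuous_open U : open U -> vker_continuous mu p (indic U).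
Proof.
move=> oU; pose Un n : set G := [set x | vcylinder n x `<=` U].
apply: (@vker_continuous_indic_cvg Un).
- move=> n; apply: (@vker_continuous_vcyl_inv n) => x y xU xy z yz.
  by apply: xU; exact: vcylinder_trans xy yz.
- exact: sub_sigma_algebra.
- move=> t; have [Ut|Ut] := EM (U t).
    have [A AU] := (open_vcylinderP U).1 oU _ Ut.
    exists A => // n /= An; split=> // _; apply: subset_trans AU.
    exact: vcylinder_le.
  by apply: nearW => n; split=> // /(_ t); apply.
Qed.

Lemma vker_continuous_indic B : measurable B -> vker_continuous mu p (indic B).
Proof.
move=> mB.
(* Measurability is carried along so that the sets in question form a sigma-algebra containing the
   open sets. *)
suff : measurable B /\ vker_continuous mu p (indic B) by case.
move: B mB; apply: smallest_sub; last first.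
  by move=> U oU; split; [exact: sub_sigma_algebra|exact: vker_continuous_open].
have setC_ B : measurable B /\ vker_continuous mu p (indic B) ->
    measurable (~` B) /\ vker_continuous mu p (indic (~` B)).
  move=> [mB hB]; split; first exact: measurableC.
  apply: (vker_continuous_dom (C := 1) _ _ _ hB (vker_continuous_cst mu p1 0)) => //.
    exact/measurable_indic/measurableC.
  move=> z; rewrite mul1r {3}/pincr subrr normr0 powR0 ?gt_eqF// addr0 /pincr.
  have e t : indic (~` B) t = 1 - indic B t 
    by rewrite /indic !indicE in_setC; case: (t \in B); rewrite ?subrr ?subr0.
  have -> : indic (~` B) z.2 - indic (~` B) z.1 = indic B z.1 - indic B z.2.
    by rewrite !e; ring.
  by rewrite distrC.
(* Two points separated by a union are separated by one of its members, so the increment of the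
   union is at most the sum of the two increments. *)
have setU_ B B' : measurable B /\ vker_continuous mu p (indic B) ->
    measurable B' /\ vker_continuous mu p (indic B') ->
    measurable (B `|` B') /\ vker_continuous mu p (indic (B `|` B')).
  move=> [mB hB] [mB' hB']; split; first exact: measurableU.
  apply: (vker_continuous_dom (C := 1) _ _ _ hB hB') => //.
    exact/measurable_indic/measurableU.
  move=> [x t]; rewrite mul1r.
  have [Bxt|Bxt] := EM (B x <-> B t); last first.
    apply: ler_wpDr; first exact: pincr_ge0.
    rewrite /pincr /= ge0_ler_powR ?nnegrE// ?(ltW p_gt0)//.
    by rewrite (indic_dist_neq Bxt).
  have [Bxt'|Bxt'] := EM (B' x <-> B' t); last first.
    apply: ler_wpDl; first exact: pincr_ge0.
    rewrite /pincr /= ge0_ler_powR ?nnegrE// ?(ltW p_gt0)//.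
    by rewrite (indic_dist_neq Bxt').
  rewrite {1}/pincr /= indic_eq; last by rewrite /setU /= Bxt Bxt'.
  by rewrite normr0 powR0 ?gt_eqF// addr_ge0// pincr_ge0.
have set0_ : measurable (set0 : set G) /\ vker_continuous mu p (indic set0).
  split; first exact: measurable0.
  by rewrite /indic indic0; exact: vker_continuous_cst.
split=> [//|B|F hF]; first by rewrite setTD; exact: setC_.
(* A countable union is reached as the pointwise limit of its finite partial unions. *)
pose UF n : set G := \big[setU/set0]_(i < n) F i.
have hU n : measurable (UF n) /\ vker_continuous mu p (indic (UF n)).
  elim: n => [|n IH]; first by rewrite /UF big_ord0.
  have -> : UF n.+1 = UF n `|` F n by rewrite /UF big_ord_recr.
  exact: (setU_ _ _ IH (hF n)).
have mF : measurable (\bigcup_k F k) by apply: bigcupT_measurable => k; exact: (hF k).1.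
split; first exact: mF.
apply: (@vker_continuous_indic_cvg UF); [by move=> n; exact: (hU n).2|exact: mF|].
move=> t; have [[k _ Fkt]|Ft] := EM ((\bigcup_k F k) t).
  exists k.+1 => // n /= kn; split=> _; first by exists k.
  by rewrite /UF -bigcup_mkord; exists k.
apply: nearW => n; split=> // ; rewrite /UF -bigcup_mkord => -[k _ Fkt].
by exists k.
Qed.

Lemma vker_continuous_sum I (s : seq I) (F : I -> G -> R) :
  (forall i, vker_continuous mu p (F i)) ->
  vker_continuous mu p (fun t => \sum_(i <- s) F i t).
Proof.
move=> hF; elim: s => [|i s IH].
  by under eq_fun do rewrite big_nil; exact: vker_continuous_cst.
under eq_fun do rewrite big_cons.
exact: (vker_continuousD p1 (hF i) IH).
Qed.

Import HBNNSimple.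

Lemma vker_continuous_nnsfun (g : {nnsfun G >-> R}) : vker_continuous mu p g.
Proof.
have -> : (g : G -> R) = fun t => \sum_(y <- finmap.enum_fset (fset_set (range g)))
    y * \1_(g @^-1` [set y]) t.
  by apply/funext => t; rewrite fimfunE fsbig_finite.
apply: vker_continuous_sum => y; apply: vker_continuousZ => //.
by apply: vker_continuous_indic; exact: measurable_funPTI.
Qed.

(** Simple functions increasing to g satisfy |g_n - g| <= g, so g^p is the dominating function. *)
Lemma vker_continuous_ge0 g : measurable_fun setT g -> (forall t, 0 <= g t) ->
  mu.-integrable setT (fun t => (g t `^ p)%:E) -> vker_continuous mu p g.
Proof.
move=> mg g0 ig; have mEg : measurable_fun setT (EFin \o g) by exact/measurable_EFinP.
pose gn := nnsfun_approx measurableT mEg.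
have gn_cvg t : gn n t @[n --> \oo] --> g t.
  have /(_ t I) := cvg_nnsfun_approx measurableT mEg (fun t _ => g0 t).
  by move=> /fine_cvgP[].
have gn_le n t : gn n t <= g t.
  rewrite /gn nnsfun_approxE -lee_fin.
  by apply: (le_approx (f := EFin \o g)) => // u _; rewrite lee_fin.
apply: (@vker_continuous_cvg _ _ m2 _ hmu _ p1 (fun n => gn n) _ (fun t => g t `^ p)) => //.
- by move=> n; exact: vker_continuous_nnsfun.
- move=> n t; rewrite ge0_ler_powR ?nnegrE// ?(ltW p_gt0)//.
  rewrite distrC ger0_norm ?subr_ge0//.
  by rewrite lerBlDr lerDl.
Qed.

Lemma vker_continuous_Lp g : measurable_fun setT g ->
  mu.-integrable setT (fun t => (`|g t| `^ p)%:E) -> vker_continuous mu p g.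
Proof.
move=> mg ig.
have pos (h : G -> R) : measurable_fun setT h -> (forall t, 0 <= h t) -> (forall t, h t <= `|g t|) ->
    vker_continuous mu p h.
  move=> mh h0 hg; apply: vker_continuous_ge0 => //.
  apply: le_integrable ig => //.
    apply/measurable_EFinP.
    exact: (measurableT_comp (measurable_powR p) mh).
  move=> t _ /=; rewrite lee_fin !(ger0_norm (powR_ge0 _ _)).
  by rewrite ge0_ler_powR ?nnegrE// ?(ltW p_gt0).
have -> : g = fun t => g^\+ t + -1 * g^\- t.
  by apply/funext => t; rewrite mulN1r -{1}[g]funrposBneg.
apply: vker_continuousD => //; last apply: vker_continuousZ => //; apply: pos.
- exact: measurable_funrpos.
- by move=> t; exact: funrpos_ge0.
- by move=> t; rewrite /funrpos ge_max ler_norm normr_ge0.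
- exact: measurable_funrneg.
- by move=> t; exact: funrneg_ge0.
- by move=> t; rewrite /funrneg ge_max -{1}normrN ler_norm normr_ge0.
Qed.

End DenseClasses.

(** * Convergence in norm *)

(** A crude Young inequality: the product is at most the p-th power of the larger of a and h. It
    takes the place of Hölder's inequality below. *)
Lemma powR_split (R : realType) (p a h : R) : 1 <= p -> 0 < a -> 0 <= h ->
  a `^ (p - 1) * h <= a `^ p + h `^ p.
Proof.
move=> p1 a0 h0; have p0 : 0 < p by apply: lt_le_trans p1.
have [ha|ah] := leP h a.
  apply: (@le_trans _ _ (a `^ p)); last by rewrite lerDl powR_ge0.
  by rewrite -(mulr_powRB1 (ltW a0) p0) mulrC ler_wpM2r// powR_ge0.
apply: (@le_trans _ _ (h `^ p)); last by rewrite lerDr powR_ge0.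
rewrite -(mulr_powRB1 h0 p0) mulrC ler_wpM2l//.
by rewrite ge0_ler_powR ?subr_ge0 ?nnegrE ?(ltW a0) ?(ltW ah)//.
Qed.

Lemma cvg_ereal0 (R : realType) (X : nat -> \bar R) : (forall n, 0 <= X n)%E ->
  (forall e : R, 0 < e -> \forall n \near \oo, (X n <= e%:E)%E) ->
  X n @[n --> \oo] --> 0%E.
Proof.
move=> X0 Xe; have fin n (e : R) : (X n <= e%:E)%E -> X n \is a fin_num.
  by move=> h; rewrite ge0_fin_numE//; apply: le_lt_trans h _; exact: ltry.
apply/fine_cvgP; split; first by apply: filterS (Xe 1 ltr01) => n; exact: fin.
apply/cvgrPdist_le => e /Xe; apply: filterS => n h /=.
by rewrite sub0r normrN ger0_norm ?fine_ge0// -lee_fin fineK// (fin _ _ h).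
Qed.

Section NormConvergence.
Variables (R : realType) (m : nat -> nat).
Hypothesis m2 : forall k, (2 <= m k)%N.
Local Notation G := (vilenkin m).
Local Notation M := (vM m).
Local Notation normc := (@ComplexField.Normc.normc R).
Variable mu : probability G R.
Hypothesis hmu : haar mu.
Variable p : R.
Hypothesis p1 : 1 <= p.
Implicit Types (x y t u : G) (A k s l n : nat) (f : G -> R[i]).

Let p_gt0 : 0 < p. Proof. exact: lt_le_trans p1. Qed.

Lemma complex_LnormE f :
  complex_Lnorm mu p f = ((\int[mu]_t (normc (f t) `^ p)%:E) `^ p^-1)%E.
Proof.
rewrite /complex_Lnorm.
rewrite unlock.
apply: (congr1 (fun z => poweR z p^-1)).
apply: eq_integral => t _.
by rewrite /= ger0_norm ?normc_ge0// poweR_EFin.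
Qed.

Lemma measurable_normc_powR f : cmeasurable f ->
  measurable_fun setT (fun t => normc (f t) `^ p).
Proof.
by move=> mf; exact: (measurableT_comp (measurable_powR p) (measurable_normc mf)).
Qed.

Lemma complex_Lp_integrable f : complex_Lp mu p f ->
  mu.-integrable setT (fun t => (normc (f t) `^ p)%:E).
Proof.
move=> [mr mi]; rewrite complex_LnormE => h; apply/integrableP; split.
  by apply/measurable_EFinP; exact: measurable_normc_powR.
have /lty_poweRy := h; rewrite invr_eq0 gt_eqF// => /(_ isT).
apply: le_lt_trans; rewrite le_eqVlt; apply/orP; left; apply/eqP.
by apply: eq_integral => t _ /=; rewrite ger0_norm// powR_ge0.
Qed.

(** [powR_split] at a = 1 gives |f| <= 1 + |f|^p, and the measure is finite. *)
Lemma complex_Lp_cintegrable f : complex_Lp mu p f -> cintegrable mu f.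
Proof.
move=> hf; have ip := complex_Lp_integrable hf; case: hf => mr mi _.
have mf : cmeasurable f by [].
apply: cintegrableP => //.
have i1 : mu.-integrable setT (fun t => 1%:E + (normc (f t) `^ p)%:E)%E.
  by apply: integrableD => //; exact: (finite_measure_integrable_cst mu 1).
apply: le_integrable i1 => //; first by apply/measurable_EFinP; exact: measurable_normc.
move=> t _ /=; rewrite lee_fin ger0_norm ?normc_ge0//.
rewrite ger0_norm ?addr_ge0 ?powR_ge0//.
have := powR_split p1 ltr01 (normc_ge0 (f t)).
by rewrite !powR1 mul1r.
Qed.

(* From [b^(p-1) h <= b^p + h^p] integrated against [vavg], optimised in b. *)
Lemma vavg_powR A x (h : G -> R) (a K : R) :
  measurable_fun setT h -> (forall t, 0 <= h t) -> 0 <= a -> 0 < K ->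
  (a%:E <= K%:E * \int[mu]_t (vavg R A x t * h t)%:E)%E ->
  ((a `^ p)%:E <= ((4 * K) `^ p)%:E * \int[mu]_t (vavg R A x t * h t `^ p)%:E)%E.
Proof.
move=> mh h0 a0 K0 aJ.
set J := (\int[mu]_t _)%E in aJ; set Q := (\int[mu]_t _)%E.
have hp0 t : 0 <= h t `^ p by exact: powR_ge0.
have mhp : measurable_fun setT (fun t => h t `^ p).
  exact: (measurableT_comp (measurable_powR p) mh).
have av0 t : 0 <= vavg R A x t by exact: vavg_ge0.
have mav := @measurable_vavgl R m A x.
have K4 : 0 < 4 * K by rewrite mulr_gt0.
have Q0 : (0 <= Q)%E by apply: integral_ge0 => t _; rewrite lee_fin mulr_ge0.
have [Qoo|Qfin] := eqVneq Q +oo%E.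
  by rewrite Qoo gt0_muley ?leey// lte_fin powR_gt0.
have {}Qfin : Q \is a fin_num by rewrite ge0_fin_numE// lt_neqAle Qfin leey.
pose q := fine Q; have q0 : 0 <= q by rewrite fine_ge0.
have QE : Q = q%:E by rewrite /q fineK.
pose c := q `^ p^-1; have c0 : 0 <= c by exact: powR_ge0.
have cp : c `^ p = q by rewrite /c -powRrM mulVf ?gt_eqF// powRr1.
(* The choice b = Q^(1/p) = c may be 0; adding d > 0 keeps b positive, and d is removed at the
   end. *)
have key d : 0 < d -> a <= 4 * K * (c + d).
  move=> d0; set b := c + d; have b0 : 0 < b by rewrite ltr_wpDl.
  have qb : q <= b `^ p.
    by rewrite -cp ge0_ler_powR ?nnegrE ?(ltW p_gt0)// ?(ltW b0)// lerDl ltW.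
  have bp0 : 0 < b `^ (p - 1) by rewrite powR_gt0.
  rewrite -(ler_pM2l bp0) [leRHS]mulrCA [b `^ _ * b]mulrC mulr_powRB1 ?(ltW b0)//.
  rewrite -lee_fin EFinM.
  apply: (@le_trans _ _ ((b `^ (p - 1))%:E * (K%:E * J))%E).
    by apply: lee_wpmul2l => //; rewrite lee_fin ltW.
  rewrite muleCA.
  (* Here 4 = 3 + 1: the mass of [vavg] in t is at most 3, and Q <= b^p. *)
  apply: (@le_trans _ _ (K%:E * (4 * b `^ p)%:E)%E); last first.
    by rewrite -EFinM lee_fin mulrCA mulrA.
  apply: lee_wpmul2l; first by rewrite lee_fin ltW.
  rewrite -ge0_integralZl//; last 3 first.
  - by apply/measurable_EFinP/measurable_funM.
  - by move=> t _; rewrite lee_fin mulr_ge0.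
  - by rewrite lee_fin ltW.
  apply: (@le_trans _ _ (\int[mu]_t ((b `^ p)%:E * (vavg R A x t)%:E
      + (vavg R A x t * h t `^ p)%:E))%E).
    apply: ge0_le_integral => //.
    - by move=> t _; rewrite -EFinM lee_fin (mulr_ge0 (ltW bp0))// mulr_ge0.
    - by apply: measurable_funeM; apply/measurable_EFinP; exact: measurable_funM.
    - apply: emeasurable_funD.
        by apply: measurable_funeM; apply/measurable_EFinP.
      by apply/measurable_EFinP/measurable_funM.
    - move=> t _; rewrite -!EFinM -EFinD lee_fin mulrCA [b `^ p * _]mulrC -mulrDr.
      by apply: ler_wpM2l => //; exact: powR_split.
  rewrite ge0_integralD//; last 4 first.
  - by move=> t _; rewrite -EFinM lee_fin mulr_ge0// powR_ge0.
  - by apply: measurable_funeM; apply/measurable_EFinP.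
  - by move=> t _; rewrite lee_fin mulr_ge0.
  - by apply/measurable_EFinP/measurable_funM.
  rewrite ge0_integralZl//; last 3 first.
  - exact/measurable_EFinP.
  - by move=> t _; rewrite lee_fin.
  - by rewrite lee_fin powR_ge0.
  rewrite -/Q QE; apply: (@le_trans _ _ ((b `^ p)%:E * 3%:E + (b `^ p)%:E)%E).
    apply: leeD; last by rewrite lee_fin.
    apply: lee_wpmul2l; first by rewrite lee_fin powR_ge0.
    exact: vavg_massl.
  by rewrite -EFinM -EFinD lee_fin; lra.
have ac : a <= 4 * K * c.
  apply/ler_addgt0Pr => e e0.
  have d0 : 0 < e / (4 * K) by rewrite divr_gt0.
  by have := key _ d0; rewrite mulrDr mulrCA divff ?gt_eqF// mulr1.
rewrite QE -EFinM lee_fin -cp -powRM ?(ltW K4)//.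
by rewrite ge0_ler_powR ?nnegrE ?(ltW p_gt0)// mulr_ge0// ltW.
Qed.

Variable f : G -> R[i].
Hypothesis hf : complex_Lp mu p f.

Let fint : cintegrable mu f. Proof. exact: complex_Lp_cintegrable. Qed.

Let mf : cmeasurable f. Proof. exact: cintegrable_measurable fint. Qed.

Let F (z : G * G) : R := normc (f z.2 - f z.1) `^ p.

Let F0 z : 0 <= F z. Proof. exact: powR_ge0. Qed.

Let mF : measurable_fun setT F.
Proof.
apply: (measurableT_comp (measurable_powR p)); apply: measurable_normc.
have [mr mi] := mf.
have m1 (g : G -> R) : measurable_fun setT g ->
    measurable_fun setT (fun z : G * G => g z.2 - g z.1).
  move=> mg; apply: measurable_funB.
    exact: measurableT_comp mg (@measurable_snd _ _ G G).
  exact: measurableT_comp mg (@measurable_fst _ _ G G).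
split.
  by under eq_fun do rewrite raddfB; exact: (m1 (fun t => complex.Re (f t))).
by under eq_fun do rewrite raddfB; exact: (m1 (fun t => complex.Im (f t))).
Qed.

Let E l : \bar R := vker_int mu l F.

Let E_ge0 l : (0 <= E l)%E.
Proof. by apply: integral_ge0 => z _; rewrite lee_fin mulr_ge0// vker_ge0. Qed.

Let phi t : R := normc (f t) `^ p.

Let mphi : measurable_fun setT phi. Proof. exact: measurable_normc_powR. Qed.

(** Bounds the increment by the values at the two points and uses both marginals. Finiteness allows
    the Cesàro argument to run in the reals. *)
Let E_fin l : E l \is a fin_num.
Proof.
have phi0 t : 0 <= phi t by exact: powR_ge0.
have mphi1 : measurable_fun setT (fun z : G * G => phi z.1).
  exact: measurableT_comp mphi (@measurable_fst _ _ G G).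
have mphi2 : measurable_fun setT (fun z : G * G => phi z.2).
  exact: measurableT_comp mphi (@measurable_snd _ _ G G).
have iphi : (\int[mu]_t (phi t)%:E < +oo)%E.
  exact: integrable_lty (complex_Lp_integrable hf).
rewrite ge0_fin_numE//.
apply: (@le_lt_trans _ _ (vker_int mu l (fun z => 2 `^ p * (phi z.2 + phi z.1)))).
  apply: le_vker_int => //.
    by apply: measurable_funM => //; exact: measurable_funD.
  move=> z; apply: le_trans (powRD_le p1 (normc_ge0 _) (normc_ge0 _)).
  rewrite /F ge0_ler_powR ?nnegrE ?(ltW p_gt0) ?addr_ge0 ?normc_ge0//.
  apply: le_trans (le_normcD _ _) _.
  by rewrite normcN.
rewrite vker_intZ//; last 2 first.
- exact: measurable_funD.
- by move=> z; rewrite addr_ge0.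
rewrite vker_intD//; apply: lte_mul_pinfty; [by rewrite lee_fin powR_ge0|by []|].
apply: lte_add_pinfty.
  by apply: le_lt_trans (vker_int_snd m2 hmu l mphi phi0) _; apply: lte_mul_pinfty.
by apply: le_lt_trans (vker_int_fst m2 hmu l mphi phi0) _; apply: lte_mul_pinfty.
Qed.

(** The modulus is at most the sum of the absolute values of the real and imaginary parts, to each
    of which [vker_continuous_Lp] applies. *)
Let E_cvg : (fine (E l)) @[l --> \oo] --> 0.
Proof.
have [mr mi] := mf.
have part (g : G -> R) : measurable_fun setT g -> (forall t, `|g t| <= normc (f t)) ->
    vker_continuous mu p g.
  move=> mg gf; apply: vker_continuous_Lp => //.
  apply: le_integrable (complex_Lp_integrable hf) => //.
    by apply/measurable_EFinP; exact: measurable_norm_powR.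
  move=> t _ /=; rewrite lee_fin !(ger0_norm (powR_ge0 _ _)).
  by rewrite ge0_ler_powR ?nnegrE ?(ltW p_gt0) ?normc_ge0.
have [_ hr] := part _ mr (fun t => ge_Re_normc (f t)).
have [_ hi] := part _ mi (fun t => ge_Im_normc (f t)).
have mpr := measurable_pincr p mr; have mpi := measurable_pincr p mi.
apply/cvgrPdist_le => e e0.
have C0 : 0 < 2 `^ p :> R by rewrite powR_gt0.
have d0 : 0 < e / 2 `^ p / 2 by rewrite !divr_gt0.
have [N1 h1] := hr _ d0; have [N2 h2] := hi _ d0.
exists (maxn N1 N2) => // l /=; rewrite geq_max => /andP[l1 l2].
rewrite sub0r normrN ger0_norm ?fine_ge0// -lee_fin fineK//.
apply: (@le_trans _ _ (vker_int mu l (fun z => 2 `^ p *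
    (pincr p (fun t => complex.Re (f t)) z + pincr p (fun t => complex.Im (f t)) z)))).
  apply: le_vker_int => //.
    by apply: measurable_funM => //; exact: measurable_funD.
  move=> z; apply: le_trans (powRD_le p1 (normr_ge0 _) (normr_ge0 _)).
  rewrite /F ge0_ler_powR ?nnegrE ?(ltW p_gt0) ?addr_ge0 ?normc_ge0//.
  by rewrite -!raddfB; exact: le_normc_ReIm.
rewrite vker_intZ//; last 2 first.
- exact: measurable_funD.
- by move=> z; rewrite addr_ge0// pincr_ge0.
rewrite vker_intD//; [|by move=> z; exact: pincr_ge0..].
apply: (@le_trans _ _ ((2 `^ p)%:E * ((e / 2 `^ p / 2)%:E + (e / 2 `^ p / 2)%:E))%E).
  apply: lee_wpmul2l; first by rewrite lee_fin ltW.
  by apply: leeD; [exact: h1|exact: h2].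
by rewrite -EFinD -EFinM lee_fin -splitr mulrCA divff ?gt_eqF// mulr1.
Qed.

(** Integrating [vavg_powR] over x bounds the p-th power of the norm by a constant times the Cesàro
    mean of the [E l], since by Tonelli the iterated integral at level l is [E l]. *)
Lemma riesz_mean_cvg_Lnorm (B : nat) : (forall k, (m k <= B)%N) ->
  complex_Lnorm mu p (fun x => riesz_mean mu n f x - f x) @[n --> \oo] --> 0%E.
Proof.
move=> mB; pose c := arithmetic_mean (fun l => fine (E l)).
have c0 : c @ \oo --> 0 by exact: cesaro.
have B0 : (0 < B)%N by apply: leq_trans (mB 0%N); apply: leq_trans (m2 0).
pose K : R := (24 * B ^ 3)%:R.
have K0 : 0 < K by rewrite ltr0n muln_gt0 expn_gt0 B0.
pose C : R := (4 * K) `^ p.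
have C0 : 0 < C by rewrite powR_gt0// mulr_gt0.
have mr n : cmeasurable (fun x => riesz_mean mu n f x - f x).
  have [a b] := cmeasurable_riesz_mean mu n f; have [a' b'] := mf.
  by split; under eq_fun do rewrite raddfB; exact: measurable_funB.
have mI l : measurable_fun setT
    (fun x => \int[mu]_t (vker R l x t * F (x, t))%:E)%E.
  apply: (measurable_fun_fubini_tonelli_F (fun z : G * G => (vker R l z.1 z.2 * F z)%:E)).
    by apply/measurable_EFinP/measurable_funM => //; exact: measurable_vker.
  by move=> z; rewrite lee_fin mulr_ge0// vker_ge0.
have I0 l x : (0 <= \int[mu]_t (vker R l x t * F (x, t))%:E)%E.
  by apply: integral_ge0 => t _; rewrite lee_fin mulr_ge0// vker_ge0.
have bound A n : (2 <= n)%N -> (M A <= n < M A.+1)%N ->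
    (\int[mu]_x (normc (riesz_mean mu n f x - f x) `^ p)%:E <= (C * c A)%:E)%E.
  move=> n2 nA.
  have hx x : measurable_fun setT (fun t => normc (f t - f x)).
    exact: measurable_normc (cintegrable_measurable (cintegrableBcst (f x) fint)).
  apply: (@le_trans _ _ (\int[mu]_x (C%:E * ((A.+1%:R^-1)%:E *
      \sum_(l < A.+1) \int[mu]_t (vker R l x t * F (x, t))%:E)))%E).
    apply: ge0_le_integral => //.
    - by move=> x _; rewrite lee_fin powR_ge0.
    - by apply/measurable_EFinP; exact: measurable_normc_powR.
    - by do 2 apply: measurable_funeM; apply: emeasurable_sum => l; exact: mI.
    - move=> x _.
      have := vavg_powR (hx x) (fun t => normc_ge0 _) (normc_ge0 _) K0
        (normc_riesz_mean_sub m2 hmu x mB fint n2 nA).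
      rewrite integral_vavg//; last by move=> t; exact: powR_ge0.
      exact: (measurableT_comp (measurable_powR p) (hx x)).
  rewrite ge0_integralZl//; last 3 first.
  - by apply: measurable_funeM; apply: emeasurable_sum => l; exact: mI.
  - by move=> x _; apply: mule_ge0; [rewrite lee_fin invr_ge0|exact: sume_ge0].
  - by rewrite lee_fin ltW.
  rewrite EFinM; apply: lee_wpmul2l; first by rewrite lee_fin ltW.
  rewrite ge0_integralZl//; last 2 first.
  - by apply: emeasurable_sum => l; exact: mI.
  - by move=> x _; exact: sume_ge0.
  rewrite /c /arithmetic_mean /series /= EFinM; apply: lee_wpmul2l.
    by rewrite lee_fin invr_ge0.
  rewrite ge0_integral_sum// big_mkord -sumEFin le_eqVlt; apply/orP; left; apply/eqP.
  by apply: eq_bigr => l _; rewrite fineK// /E vker_int_iter.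
apply: cvg_ereal0 => [n|e e0]; first by rewrite complex_LnormE poweR_ge0.
have d0 : 0 < e `^ p / C by rewrite divr_gt0// powR_gt0.
have /cvgrPdist_le/(_ _ d0)[N _ hN] := c0.
near=> n.
have n2 : (2 <= n)%N by near: n; exact: nbhs_infty_ge.
have nM : (M N <= n)%N by near: n; exact: nbhs_infty_ge.
have [A /[dup] nA /andP[_ nA']] := vM_bracket m2 (ltnW n2).
have /= := hN A (vM_bracket_ge m2 nM nA').
rewrite sub0r normrN => /ler_normlW cA.
have Ie : (\int[mu]_x (normc (riesz_mean mu n f x - f x) `^ p)%:E <= (e `^ p)%:E)%E.
  apply: (le_trans (bound A n n2 nA)); rewrite lee_fin.
  by rewrite mulrC -ler_pdivlMr.
rewrite complex_LnormE.
have -> : e%:E = ((e `^ p)%:E `^ p^-1)%E.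
  by rewrite poweR_EFin -powRrM divff ?gt_eqF// powRr1// ltW.
apply: gt0_ler_poweR => //.
- by rewrite invr_ge0 ltW.
- rewrite in_itv /= leey andbT.
  by apply: integral_ge0 => x _; rewrite lee_fin powR_ge0.
- by rewrite in_itv /= leey andbT lee_fin powR_ge0.
Unshelve. all: by end_near. Qed.

End NormConvergence.

Theorem mainTheorem17 (R : realType) (m : nat -> nat)
    (hm : forall k, (2 <= m k)%N) (hb : exists B, forall k, (m k <= B)%N)
    (mu : probability (vilenkin m) R) (hmu : haar mu)
    (p : R) (hp : 1 <= p)
    (f : vilenkin m -> R[i]%C) (hf : complex_Lp mu p f) :
  (complex_Lnorm mu p (fun x => riesz_mean mu n f x - f x) @[n --> \oo] --> 0%E)
  /\
  (forall x : vilenkin m, vilenkin_lebesgue_point mu f x ->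
     (riesz_mean mu n f x : R[i]%C^o) @[n --> \oo] --> (f x : R[i]%C^o)).
Proof.
have [B mB] := hb; split; first exact: (riesz_mean_cvg_Lnorm hm hmu hp hf mB).
move=> x hx; have fint := complex_Lp_cintegrable hp hf.
exact: (riesz_mean_cvg_lebesgue_point hm hmu fint hx mB).
Qed.
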